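(* Let $n\in\mathbb N=\{0,1,2,\dots\}$, $r>0$, $k_{\max}>n\pi$, $M>0$ and $0<\varepsilon<1$. There exists a constant $\xi_{n,k_{\max}}$, depending only on $n,k_{\max},r,M,\varepsilon$, such that for all real-valued $h_n,h_{n,\mathrm{app}}\in H^1(-r,r)$ with $\|h_n\|_{H^1(-r,r)}\le M$ and $\|h_{n,\mathrm{app}}\|_{H^1(-r,r)}\le M$, setting $d_n(k)=\Gamma(h_n)(k)$ and $d_{n,\mathrm{app}}(k)=\Gamma(h_{n,\mathrm{app}})(k)$ for $k\in\left(n\pi,k_{\max}+\sqrt{k_{\max}^2-n^2\pi^2}\right)$, one has $$\|h_n-h_{n,\mathrm{app}}\|_{L^2(-r,r)}^2\le\xi_{n,k_{\max}}\|d_n-d_{n,\mathrm{app}}\|_{\mathrm H}^{2-2\varepsilon}+\frac4\pi\|d_n-d_{n,\mathrm{app}}\|_{\mathrm H}^2+\frac{8\pi}{\left(k_{\max}+\sqrt{k_{\max}^2-n^2\pi^2}\right)^2}M^2 .$$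
   Context: Functions on $(-r,r)$ are extended by $0$ to $\mathbb R$, and $\Gamma(f)(\omega)=\frac{i}{2\omega}\int_{\mathbb R} f(z)e^{i\omega z}\,dz$ for $\omega>0$. For a function $v$ defined on an interval $I\subset(0,+\infty)$, $\|v\|_{\mathrm H}^2=\int_I\omega^2|v(\omega)|^2\,d\omega$; here $I=\left(n\pi,k_{\max}+\sqrt{k_{\max}^2-n^2\pi^2}\right)$. *)

(* Defs.v *)
From HB Require Import structures.
From mathcomp Require Import all_boot all_order all_algebra.
From mathcomp Require Import all_classical all_reals all_analysis.
From mathcomp Require Export complex.

Set Implicit Arguments.
Unset Strict Implicit.
Unset Printing Implicit Defensive.

Import Order.TTheory GRing.Theory Num.Theory.
Import numFieldNormedType.Exports.

Local Open Scope ring_scope.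
Local Open Scope complex_scope.
Local Open Scope classical_set_scope.

(* A function on [A] is represented by a total function [R -> R] whose values
   outside [A] are irrelevant. Classes of L^2(A) and H^1(A) are given by Borel
   representatives. [f \_ A] is the extension of [f|_A] by 0: *)
Fact restrict_zero_ext (R : realType) (A : set R) (f : R -> R) (x : R) :
  (f \_ A) x = if x \in A then f x else 0.
Proof. by []. Qed.

Definition L2norm (R : realType) (A : set R) (f : R -> R) : \bar R :=
  'N[lebesgue_measure]_2%:E[EFin \o (f \_ A)]%E.

Definition inL2 (R : realType) (A : set R) (f : R -> R) : Prop :=
  (f \_ A : measurableTypeR R -> R) \in Lfun lebesgue_measure 2%:E.

(* Elements of C_c^oo(A), extended by 0. *)
Definition test_function (R : realType) (A : set R) (phi : R -> R) : Prop :=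
  [/\ forall (m : nat) (x : R), derivable (derive1n m phi) x 1,
      compact (closure [set x | phi x != 0]) &
      closure [set x | phi x != 0] `<=` A].

Definition is_weak_derivative (R : realType) (A : set R) (f g : R -> R) : Prop :=
  forall phi : R -> R, test_function A phi ->
    \int[lebesgue_measure]_(x in A) (f x * derive1 phi x)
    = - \int[lebesgue_measure]_(x in A) (g x * phi x).

Definition inH1 (R : realType) (A : set R) (f : R -> R) : Prop :=
  inL2 A f /\ exists g : R -> R, inL2 A g /\ is_weak_derivative A f g.

(* Some square-integrable weak derivative of [f] on [A], unique up to a null set
   when [A] is open; 0 if [f] has none. *)
Definition weak_derivative (R : realType) (A : set R) (f : R -> R) : R -> R :=
  xget (cst 0) [set g | inL2 A g /\ is_weak_derivative A f g].

Definition H1norm (R : realType) (A : set R) (f : R -> R) : \bar R :=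
  ((L2norm A f ^+ 2 + L2norm A (weak_derivative A f) ^+ 2) `^ 2^-1)%E.

(* exp(i t) for real t *)
Definition expi (R : realType) (t : R) : R[i] := cos t +i* sin t.

Definition Cintegral (R : realType) (F : R -> R[i]) : R[i] :=
  (\int[lebesgue_measure]_(z in [set: R]) complex.Re (F z))
  +i* (\int[lebesgue_measure]_(z in [set: R]) complex.Im (F z)).

Definition Gamma (R : realType) (f : R -> R) (w : R) : R[i] :=
  'i%C / (2 * w)%:C * Cintegral (fun z => (f z)%:C * expi (w * z)).

(* |.|_H : the L^2(A)-norm with weight w^2; [normc] is the real-valued modulus. *)
Definition Hnorm (R : realType) (A : set R) (v : R -> R[i]) : \bar R :=
  ((\int[lebesgue_measure]_(w in A)
      (w ^+ 2 * ComplexField.Normc.normc (v w) ^+ 2)%:E) `^ 2^-1)%E.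

(* Main.v *)
Require Import Defs.
From mathcomp Require Import all_boot all_order all_algebra.
From mathcomp Require Import all_classical all_reals all_analysis.
From mathcomp Require Import measurable_realfun ring lra.
Import Order.TTheory GRing.Theory Num.Theory.
Import numFieldNormedType.Exports.
Set Implicit Arguments.
Unset Strict Implicit.
Unset Printing Implicit Defensive.
Local Open Scope classical_set_scope.
Local Open Scope ring_scope.

(** The last term of the bound, 8 pi M^2 / K^2, is a fixed positive constant c.
    The inequality therefore follows from a compactness statement, [stability]:
    there is del > 0 such that two functions in the H^1 ball of radius M whose
    data differ by less than del in the weighted norm differ by at most c in
    squared L^2 norm. If the data are that close, the constant c alone
    suffices. Otherwise the squared L^2 distance, which never exceeds 4 M^2, is
    at most xi times the (2 - 2 eps)-th power of the data distance, for
    xi = 4 M^2 / del^(2 - 2 eps).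

    Stability is proved by contradiction. Take pairs violating it for
    del = 1, 1/2, 1/3, ..., and let f_j be the differences, extended by 0.

    - An H^1 bound gives a modulus of continuity outside a null set.
      Testing the weak derivative against a smooth plateau between two Lebesgue
      points x < y compares h x - h y with the integral of the derivative over
      [x, y] ([weak_derivative_modulus]). This also yields a uniform bound
      ([H1_regular]). Outside one null set the f_j are thus equicontinuous and
      uniformly bounded.

    - Small data means that the cosine and sine transforms of f_j are small in
      L^2 on the frequency band. As these transforms are Lipschitz in the
      frequency, they tend to 0 at each point of the band ([band_energy_null]).

    - A whole band of frequencies sees everything. The functions phi for which
      the integrals of f_j phi tend to 0 form a vector space closed under
      uniform limits. Difference quotients in the frequency w show that it
      contains (z - x)^k cos (w (z - x)) for each k
      ([weakly_null_moments]), hence any polynomial times cos (w (z - x)).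

    - Powers of a concave parabola are polynomial kernels concentrated at x.
      Integrating f_j against such a kernel recovers f_j x up to an error that
      the equicontinuity makes small, so f_j x tends to 0
      ([pointwise_null]).

    By dominated convergence the squared L^2 norms of the f_j tend to 0
    ([energy_null]), against their choice. *)

(** * Smooth cut-off functions *)

Section Smooth.
Context {R : realType}.
Implicit Types (f g : R -> R) (m k : nat) (x t : R).

(** The recursion runs through the derivative, not through [derive1n], so that
    the closure properties follow from the rules for one derivative by
    induction on [m]. *)
Fixpoint differentiable_upto m f : Prop :=
  if m is p.+1 then (forall x, derivable f x 1) /\ differentiable_upto p (derive1 f)
  else True.

Lemma differentiable_uptoS m f f' : (forall x, is_derive x 1 f (f' x)) ->
  differentiable_upto m f' -> differentiable_upto m.+1 f.
Proof.
move=> df Cf'; split=> [x|]; first exact: ex_derive.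
suff -> : (derive1 f) = f' by [].
by apply/funext => x; rewrite derive1E derive_val.
Qed.

Lemma differentiable_uptoW m f :
  differentiable_upto m.+1 f -> differentiable_upto m f.
Proof. by elim: m f => // m IH f [df Cf]; split => //; exact: IH. Qed.

Lemma derivable_derive1n m f : differentiable_upto m.+1 f ->
  forall x, derivable (derive1n m f) x 1.
Proof.
elim: m f => [|m IH] f [df Cf] x; first by rewrite derive1n0; exact: df.
by rewrite derive1Sn; exact: IH.
Qed.

Lemma is_derive_derive1 m f x :
  differentiable_upto m.+1 f -> is_derive x 1 f ((derive1 f) x).
Proof. by move=> [df _]; rewrite derive1E; apply: derivableP; exact: df. Qed.

Lemma differentiable_upto_cst m (c : R) : differentiable_upto m (fun=> c).
Proof.
elim: m c => // m IH c; apply: (differentiable_uptoS (f' := fun=> 0)) => //.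
Qed.

Lemma differentiable_uptoD m f g : differentiable_upto m f ->
  differentiable_upto m g -> differentiable_upto m (fun x => f x + g x).
Proof.
elim: m f g => // m IH f g Cf Cg.
apply: (differentiable_uptoS (f' := fun x => (derive1 f) x + (derive1 g) x)) => [x|].
  exact: is_deriveD (is_derive_derive1 x Cf) (is_derive_derive1 x Cg).
by apply: IH; [case: Cf|case: Cg].
Qed.

Lemma differentiable_uptoM m f g : differentiable_upto m f ->
  differentiable_upto m g -> differentiable_upto m (fun x => f x * g x).
Proof.
elim: m f g => // m IH f g Cf Cg.
apply: (differentiable_uptoS (f' := fun x => f x * (derive1 g) x + g x * (derive1 f) x)).
  move=> x.
  exact: is_deriveM (is_derive_derive1 x Cf) (is_derive_derive1 x Cg).
apply: differentiable_uptoD; apply: IH.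
- exact: differentiable_uptoW.
- by case: Cg.
- exact: differentiable_uptoW.
- by case: Cf.
Qed.

Lemma differentiable_upto_scale m (c : R) f : differentiable_upto m f ->
  differentiable_upto m (fun x => c * f x).
Proof. by apply: differentiable_uptoM; exact: differentiable_upto_cst. Qed.

(** The derivative of 1 / f is - f' (1 / f)^2, so the induction hypothesis for
    1 / f itself is what makes the step work. *)
Lemma differentiable_uptoV m f : (forall x, f x != 0) ->
  differentiable_upto m f -> differentiable_upto m (fun x => (f x)^-1).
Proof.
move=> f0; elim: m => // m IH Cf.
have CfV := IH (differentiable_uptoW Cf).
apply: (differentiable_uptoS
  (f' := fun x => - 1 * ((f x)^-1 * (f x)^-1 * (derive1 f) x))) => [x|].
  apply: (is_derive_eq (is_deriveV (f0 x) (is_derive_derive1 x Cf))).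
  by rewrite /GRing.scale/= expr2 invfM; ring.
apply: differentiable_upto_scale.
by do 2?[apply: differentiable_uptoM]; rewrite //; case: Cf.
Qed.

Lemma differentiable_upto_affine m f (a b : R) : differentiable_upto m f ->
  differentiable_upto m (fun x => f (a * x + b)).
Proof.
elim: m f => // m IH f Cf.
apply: (differentiable_uptoS (f' := fun x => a * (derive1 f) (a * x + b))) => [x|].
  have da : is_derive x 1 (fun x => a * x + b) a.
    apply: (is_derive_eq (is_deriveD (is_deriveZ a (is_derive_id x 1))
                                     (is_derive_cst b x 1))).
    by rewrite addr0 /GRing.scale/= mulr1.
  rewrite mulrC; 
  have df := is_derive_derive1 (a * x + b) Cf.
  exact: (@is_derive1_comp _ f (fun x => a * x + b) x _ _ df da).
by apply: differentiable_upto_scale; apply: IH; case: Cf.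
Qed.

(** t^-k exp (-1/t) continued by 0: unlike exp (-1/t) alone, this family is
    closed under differentiation, up to linear combinations. *)
Definition flat k t : R := if 0 < t then t^-1 ^+ k * expR (- t^-1) else 0.

Lemma flat_ge0 k t : 0 <= flat k t.
Proof.
rewrite /flat; case: ifPn => // t0.
by rewrite mulr_ge0 ?expR_ge0// exprn_ge0// invr_ge0 ltW.
Qed.

(** For s = 1/t this is s^k <= k! exp s, one term of the exponential series. *)
Lemma flat_bound k t : flat k t <= k`!%:R.
Proof.
rewrite /flat; case: ifPn => [t0|_]; last exact: ler0n.
have s0 : 0 <= t^-1 by rewrite invr_ge0 ltW.
rewrite expRN ler_pdivrMr ?expR_gt0//.
case: k => [|k].
  by rewrite expr0 fact0 mul1r (le_trans _ (expR_ge1Dx _))// lerDl.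
rewrite mulrC -ler_pdivrMr ?ltr0n ?fact_gt0//.
by rewrite (le_trans _ (expR_ge1Dxn k s0))// lerDr.
Qed.

Lemma flatS k t : t * flat k.+1 t = flat k t.
Proof.
rewrite /flat; case: ifPn => [t0|_]; last by rewrite mulr0.
by rewrite exprS mulrA mulrA mulfV ?gt_eqF// mul1r.
Qed.

Lemma flat0 k : flat k 0 = 0.
Proof. by rewrite /flat ltxx. Qed.

(** Only the origin is delicate. There the difference quotient of [flat k] is
    [flat k.+1] by [flatS], and [flat k.+1 z] tends to 0 because it is z times
    the bounded function [flat k.+2]. *)
Lemma is_derive_flat k t :
  is_derive t 1 (flat k) (- k%:R * flat k.+1 t + flat k.+2 t).
Proof.
have [t0|t0|->] := ltgtP t 0.
- rewrite /flat !ltNge (ltW t0)/= mulr0 addr0.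
  apply: (@near_eq_is_derive _ _ _ (fun=> 0) _ _ _ _ _ (is_derive_cst 0 t 1)).
  by apply: filterS (lt_nbhsl t0) => z /ltW z0; rewrite ltNge z0.
- have dV : is_derive t 1 (fun z : R => z^-1) (- t ^- 2).
    apply: (is_derive_eq (is_deriveV (lt0r_neq0 t0) (is_derive_id t 1))).
    by rewrite /GRing.scale/= mulr1.
  have dE : is_derive t 1 (fun z : R => expR (- z^-1)) (expR (- t^-1) * t ^- 2).
    have dN := is_deriveN dV; rewrite opprK in dN.
    exact: (@is_derive1_comp _ expR _ _ _ _ (is_derive_expR _) dN).
  have dF := is_deriveM (is_deriveX k dV) dE.
  have XE z : (((fun z : R => z^-1) : R -> R) ^+ k) z = z^-1 ^+ k.
    by elim: k {dF} => // k IH; rewrite !exprS -IH.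
  have E : {near t, (((fun z : R => z^-1) ^+ k : R -> R) *
                     (fun z : R => expR (- z^-1))) =1 flat k}.
    by apply: filterS (lt_nbhsr t0) => z z0; rewrite /flat z0 -XE.
  apply: (near_eq_is_derive E); apply: (is_derive_eq dF).
  rewrite /flat t0 /GRing.scale/= XE -exprVn.
  by case: k {dF E XE} => [|k]; rewrite /= !exprS ?expr0; ring.
- rewrite !flat0 mulr0 addr0; apply/is_derive1_caratheodory.
  exists (flat k.+1); split; last exact: flat0.
  + by move=> z; rewrite flat0 !subr0 mulrC flatS.
  + suff F0 : flat k.+1 z @[z --> 0] --> (0 : R).
      by move: F0; rewrite -[X in _ --> X](flat0 k.+1).
    apply/cvgr0Pnorm_le => /= e e0.
    have c0 : 0 < (k.+2)`!%:R :> R by rewrite ltr0n fact_gt0.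
    near=> z; rewrite -flatS normrM (ger0_norm (flat_ge0 _ _)).
    rewrite (@le_trans _ _ (`|z| * (k.+2)`!%:R))//.
      by rewrite ler_wpM2l ?flat_bound.
    rewrite -ler_pdivlMr//; near: z.
    exists (e / (k.+2)`!%:R) => [/=|z /=]; first exact: divr_gt0.
    by rewrite sub0r normrN => /ltW.
Unshelve. all: by end_near. Qed.

Lemma differentiable_upto_flat m k : differentiable_upto m (flat k).
Proof.
elim: m k => // m IH k; apply: (differentiable_uptoS (is_derive_flat k)).
by apply: differentiable_uptoD => //; exact: differentiable_upto_scale.
Qed.

Lemma flat_gt0 k t : 0 < t -> 0 < flat k t.
Proof. by move=> t0; rewrite /flat t0 mulr_gt0 ?expR_gt0// exprn_gt0// invr_gt0. Qed.

(** The affine map is spelled [- 1 * t + 1], in the form a * t + b that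
    [differentiable_upto_affine] recognizes. *)
Definition smooth_step t := flat 0 t / (flat 0 t + flat 0 (- 1 * t + 1)).

Lemma smooth_step_den t : 0 < flat 0 t + flat 0 (- 1 * t + 1).
Proof.
have [t0|t0] := ltP 0 t; first by rewrite ltr_pwDl ?flat_gt0 ?flat_ge0.
rewrite ltr_pwDr ?flat_ge0// flat_gt0//.
by lra.
Qed.

Lemma differentiable_upto_smooth_step m : differentiable_upto m smooth_step.
Proof.
apply: differentiable_uptoM; first exact: differentiable_upto_flat.
apply: differentiable_uptoV => [t|]; first by rewrite gt_eqF ?smooth_step_den.
apply: differentiable_uptoD; first exact: differentiable_upto_flat.
by apply: (@differentiable_upto_affine m (flat 0)); exact: differentiable_upto_flat.
Qed.

Lemma flat_le0 k t : t <= 0 -> flat k t = 0.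
Proof. by move=> t0; rewrite /flat ltNge t0. Qed.

Lemma smooth_step_eq0 t : t <= 0 -> smooth_step t = 0.
Proof. by move=> t0; rewrite /smooth_step flat_le0// mul0r. Qed.

Lemma smooth_step_eq1 t : 1 <= t -> smooth_step t = 1.
Proof.
move=> t1; rewrite /smooth_step (@flat_le0 _ (- 1 * t + 1)); last by lra.
by rewrite addr0 divff// gt_eqF// flat_gt0//; lra.
Qed.

Lemma smooth_step_itv t : 0 <= smooth_step t <= 1.
Proof.
rewrite divr_ge0 ?flat_ge0 ?(ltW (smooth_step_den _))//=.
by rewrite ler_pdivrMr ?smooth_step_den// mul1r lerDl flat_ge0.
Qed.

Lemma derive1_smooth_step_out t : t \notin `[0, 1] -> derive1 smooth_step t = 0.
Proof.
rewrite in_itv/= negb_and -!ltNge derive1E => /orP[t0|t1].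
  rewrite (@near_eq_derive R R^o R^o _ (fun=> 0 : R^o)) ?derive_cst//.
  by apply: filterS (lt_nbhsl t0) => z /ltW z0; rewrite smooth_step_eq0.
rewrite (@near_eq_derive R R^o R^o _ (fun=> 1 : R^o)) ?derive_cst//.
by apply: filterS (lt_nbhsr t1) => z /ltW z0; rewrite smooth_step_eq1.
Qed.

Lemma differentiable_upto_continuous f :
  differentiable_upto 1 f -> continuous f.
Proof.
by move=> [df _] x; apply/differentiable_continuous/derivable1_diffP.
Qed.

Lemma continuous_derive1_smooth_step : continuous (derive1 smooth_step).
Proof.
by apply: differentiable_upto_continuous; case: (differentiable_upto_smooth_step 2).
Qed.

Lemma derive1_smooth_step_bounded :
  exists2 C, 0 < C & forall t, `|derive1 smooth_step t| <= C.
Proof.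
have [c _ cP] := @EVT_max R (fun t => `|derive1 smooth_step t|) 0 1 ler01
  (continuous_subspaceT (fun t => continuous_comp
    (@continuous_derive1_smooth_step t) (@norm_continuous _ _ _))).
exists (`|derive1 smooth_step c| + 1); first by rewrite ltr_wpDl.
move=> t; have [t01|/derive1_smooth_step_out ->] := boolP (t \in `[0, 1]).
  by rewrite (le_trans (cP _ t01))// lerDl.
by rewrite normr0 addr_ge0.
Qed.

End Smooth.

(** * Integrals over the line *)

Section Integrals.
Context {R : realType}.
Implicit Types (u v f g phi : R -> R).
Local Notation mu := (@lebesgue_measure R).
Local Notation integ f := (mu.-integrable [set: R] (EFin \o f)).

Lemma poweR_half_sqr (x : \bar R) : (0 <= x -> (x `^ 2^-1) ^+ 2 = x)%E.
Proof.
by move=> x0; rewrite poweR12_sqrt// sqr_sqrte.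
Qed.

Lemma L2norm_sqr (A : set R) f :
  (L2norm A f ^+ 2 = \int[mu]_x ((f \_ A) x ^+ 2)%:E)%E.
Proof.
rewrite /L2norm unlock.
have I0 : (0 <= \int[mu]_x (`|(EFin \o f \_ A) x| `^ 2))%E.
  by apply: integral_ge0 => x _; exact: poweR_ge0.
rewrite poweR_half_sqr//; apply: eq_integral => x _ /=.
rewrite powR_mulrn// real_normK ?num_real//.
Qed.

Lemma integrable_scale (c : R) f : integ f -> integ (fun x => c * f x).
Proof. exact: (@integrableZl _ _ R mu setT measurableT c). Qed.

Lemma integrable_add f g : integ f -> integ g -> integ (fun x => f x + g x).
Proof. exact: (@integrableD _ _ R mu setT measurableT). Qed.

Lemma integrable_sub f g : integ f -> integ g -> integ (fun x => f x - g x).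
Proof. exact: (@integrableB _ _ R mu setT measurableT). Qed.

Lemma integrable_le f g : measurable_fun setT f -> integ g ->
  (forall x, `|f x| <= g x) -> integ f.
Proof.
move=> mf ig fg; apply: (@le_integrable _ _ R mu setT measurableT _ _ _ _ ig).
  exact/measurable_EFinP.
by move=> x _ /=; rewrite lee_fin (le_trans (fg x))// ler_norm.
Qed.

Lemma integrableM_bounded u phi (C : R) : integ u -> measurable_fun setT phi ->
  (forall x, `|phi x| <= C) -> integ (fun x => u x * phi x).
Proof.
move=> iu mphi phiC; apply: (integrableMl measurableT iu mphi).
exists C; split => [|M CM x _]; first exact: num_real.
exact: le_trans (phiC x) (ltW CM).
Qed.

(** On a bounded interval L^2 is contained in L^1, as |y| <= 1 + y^2. *)
Lemma inL2_integrable (r : R) f (D := `](- r), r[%classic) : inL2 D f ->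
  integ (f \_ D) /\ integ (fun x => (f \_ D) x ^+ 2).
Proof.
move=> L2f; have i2 := Lfun2_integrable_sqr L2f; split => //.
have mf : measurable_fun setT (f \_ D).
  by move: L2f => /andP[/[!inE]].
have iD : integ (\1_D) by exact: integrable_indic_itv.
apply: (@le_integrable _ _ R mu setT measurableT _
  (EFin \o (fun x => (\1_D) x + (f \_ D) x ^+ 2))).
- exact/measurable_EFinP.
- move=> x _ /=; rewrite lee_fin [leRHS]ger0_norm ?addr_ge0 ?sqr_ge0//.
  rewrite indicE patchE; case: ifPn => _; rewrite ?normr0 ?addr_ge0 ?sqr_ge0//=.
  have := normr_ge0 (f x); rewrite -[X in _ + X]real_normK ?num_real//.
  by move: `|f x| => t t0; nra.
- exact: (integrableD measurableT iD i2).
Qed.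

End Integrals.

(** * Approximate evaluation at Lebesgue points *)

Section Ramp.
Context {R : realType}.
Implicit Types (u f : R -> R) (x z t : R) (m : nat).
Local Notation mu := (@lebesgue_measure R).
Local Notation integ f := (mu.-integrable [set: R] (EFin \o f)).

(** A smooth climb from 0 to 1 across [x, x + t]. Its derivative is a bump of
    mass 1 and height O(1/t) on that interval, that is, an approximation of the
    unit mass at x. *)
Definition ramp t x z : R := smooth_step (t^-1 * z + - (t^-1 * x)).

Lemma differentiable_upto_ramp m t x : differentiable_upto m (ramp t x).
Proof.
apply: (@differentiable_upto_affine R m smooth_step).
exact: differentiable_upto_smooth_step.
Qed.

Lemma is_derive_ramp t x z :
  is_derive z 1 (ramp t x) (derive1 (ramp t x) z).
Proof. exact: is_derive_derive1 (differentiable_upto_ramp 1 t x). Qed.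

Lemma derive1_ramp t x z :
  derive1 (ramp t x) z = t^-1 * derive1 smooth_step (t^-1 * z + - (t^-1 * x)).
Proof.
have da : is_derive z 1 (fun z => t^-1 * z + - (t^-1 * x)) t^-1.
  apply: (is_derive_eq (is_deriveD (is_deriveZ t^-1 (is_derive_id z 1))
                                   (is_derive_cst (- (t^-1 * x)) z 1))).
  by rewrite addr0 /GRing.scale/= mulr1.
have ds := is_derive_derive1 (t^-1 * z + - (t^-1 * x))
  (differentiable_upto_smooth_step 1).
rewrite derive1E mulrC.
exact: (@derive_val _ _ _ _ _ _ _ (@is_derive1_comp _ _ _ z _ _ ds da)).
Qed.

Lemma continuous_derive1_ramp t x : continuous (derive1 (ramp t x)).
Proof.
by apply: differentiable_upto_continuous; case: (differentiable_upto_ramp 2 t x).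
Qed.

Lemma ramp_eq0 t x z : 0 < t -> z <= x -> ramp t x z = 0.
Proof.
move=> t0 zx; apply: smooth_step_eq0.
by rewrite -mulrBr mulr_ge0_le0 ?invr_ge0 ?(ltW t0)// subr_le0.
Qed.

Lemma ramp_eq1 t x z : 0 < t -> x + t <= z -> ramp t x z = 1.
Proof.
move=> t0 zx; apply: smooth_step_eq1.
by rewrite -mulrBr -ler_pdivrMl ?invr_gt0// invrK mulr1 lerBrDl.
Qed.

Lemma derive1_ramp_out t x z : 0 < t -> z \notin `[x, x + t] ->
  derive1 (ramp t x) z = 0.
Proof.
move=> t0 zx; rewrite derive1_ramp derive1_smooth_step_out ?mulr0//.
apply: contra zx; rewrite !in_itv/= -mulrBr => /andP[h1 h2].
move: h1 h2; rewrite pmulr_rge0 ?invr_gt0// subr_ge0 => ->/=.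
by rewrite mulrC ler_pdivrMr// mul1r lerBlDl.
Qed.

Lemma derive1_ramp_bounded : exists2 C : R, 0 < C &
  forall t x z, 0 < t -> `|derive1 (ramp t x) z| <= C / t.
Proof.
have [C C0 CP] := @derive1_smooth_step_bounded R.
exists C => // t x z t0; rewrite derive1_ramp normrM mulrC.
rewrite (@ger0_norm _ t^-1); last by rewrite invr_ge0 ltW.
by rewrite ler_pM2r ?invr_gt0.
Qed.

Lemma integrable_derive1_ramp t x : 0 < t -> integ (derive1 (ramp t x)).
Proof.
move=> t0; have [C C0 CP] := derive1_ramp_bounded.
apply: (@le_integrable _ _ R mu setT measurableT _
  (EFin \o (fun z => \1_(`[x, x + t]%classic) z * (C / t)))).
- apply/measurable_EFinP; apply: continuous_measurable_fun.
  exact: continuous_derive1_ramp.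
- move=> z _ /=; rewrite lee_fin; have [zI|zI] := boolP (z \in `[x, x + t]).
    by rewrite indicE mem_set// mul1r (le_trans (CP t x z t0)) ?ler_norm.
  by rewrite derive1_ramp_out ?normr0.
- have iI : integ (\1_(`[x, x + t]%classic)) by exact: integrable_indic_itv.
  by apply: (integrableM_bounded (C := `|C / t|) iI).
Qed.

Lemma Rintegral_derive1_ramp t x : 0 < t -> \int[mu]_z derive1 (ramp t x) z = 1.
Proof.
move=> t0.
have -> : derive1 (ramp t x) = derive1 (ramp t x) \_ `[x, x + t]%classic.
  apply/funext => z; rewrite patchE; case: ifPn => // /negP zI.
  by rewrite derive1_ramp_out//; apply/negP => ?; apply: zI; exact/mem_set.
rewrite -Rintegral_mkcond /Rintegral (@continuous_FTC2 R _ (ramp t x))//=.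
- by rewrite ramp_eq1// ramp_eq0// subr0.
- by rewrite ltrDl.
- exact/continuous_subspaceT/continuous_derive1_ramp.
- have cr : continuous (ramp t x).
    exact: differentiable_upto_continuous (differentiable_upto_ramp 1 t x).
  split.
  + by move=> z _; exact: (differentiable_upto_ramp 1 t x).1.
  + by apply: cvg_at_right_filter; exact: cr.
  + by apply: cvg_at_left_filter; exact: cr.
Qed.

(** The bump has mass 1, so the error is the integral of (u z - u x) times the
    bump. The bump is at most C / t and lives within 2 t of x, so the error is at
    most 4 C times the mean of |u - u x| over the ball of radius 2 t, and that
    mean tends to 0 at a Lebesgue point. *)
Lemma lebesgue_pt_ramp u x (e : R) : integ u -> lebesgue_pt u x -> 0 < e ->
  exists2 t0 : R, 0 < t0 & forall t, 0 < t -> t < t0 ->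
    `|\int[mu]_z (u z * derive1 (ramp t x) z) - u x| <= e.
Proof.
move=> iu ux e0; have [C C0 CP] := derive1_ramp_bounded.
have c0 : 0 < e / (4 * C) by rewrite divr_gt0// mulr_gt0.
have [t0 /= t00 t0P] : \forall t \near 0^'+, (davg u x t < (e / (4 * C))%:E)%E.
  have c0' : (0 < (e / (4 * C))%:E)%E by rewrite lte_fin.
  apply: (ux [set y | (y < (e / (4 * C))%:E)%E]).
  exact: lt_nbhsl.
exists (t0 / 2); first by rewrite divr_gt0.
move=> t tp tt.
have t2 : 0 < 2 * t by rewrite mulr_gt0.
(* Radius 2 t, since the open ball of radius t misses the end point x + t. *)
set B : set R := ball x (2 * t).
have mB : measurable B by exact: measurable_ball.
pose w := (fun z => `|u z - u x|) \_ B.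
have mu_ : measurable_fun setT u by apply/measurable_EFinP; case/integrableP: iu.
have mw : measurable_fun setT (fun z => `|u z - u x|).
  by apply: (measurableT_comp (@normr_measurable R setT)); exact: measurable_funB.
have iw : integ w.
  have iI : integ (\1_(`[x - 2 * t, x + 2 * t]%classic)).
    exact: integrable_indic_itv.
  have iu' : integ (fun z => `|u z|) by exact: integrable_norm.
  apply: (integrable_le _ (integrable_add iu' (integrable_scale `|u x| iI))).
    by apply: (measurable_restrictT _ mB).1; exact: measurable_funTS.
  move=> z; rewrite /w patchE; case: ifPn => zB; last first.
    by rewrite normr0 addr_ge0// mulr_ge0.
  rewrite normr_id indicE mem_set ?mulr1; first exact: ler_normB.
  move: zB; rewrite inE /B /ball/= ltr_norml in_itv/= => /andP[? ?].
  by apply/andP; split; lra.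
have wle : \int[mu]_z w z <= e / C * t.
  have := t0P (2 * t); rewrite /= sub0r normrN gtr0_norm// => dP.
  have {dP} : (davg u x (2 * t) < (e / (4 * C))%:E)%E by apply: dP; lra.
  rewrite /davg /iavg (lebesgue_measure_ball _ (ltW t2)) /w.
  rewrite -Rintegral_mkcond /Rintegral -/B.
  have <- : (\int[mu]_(y in B) (`|u y - u x|)%:E = \int[mu]_(y in B) `|((center (u x) \o u) y)%:E|)%E.
    by [].
  have /fineK <- : (\int[mu]_(y in B) (`|u y - u x|)%:E)%E \is a fin_num.
    have iB : mu.-integrable B (EFin \o (fun y => `|u y - u x|)).
      have := @integrable_mkcond _ _ R mu B (EFin \o (fun y => `|u y - u x|)) mB.
      by move=> ->; rewrite restrict_EFin.
    by apply: integrable_fin_num.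
  set X := fine _; rewrite inver gt_eqF ?pmulrn_lgt0// -EFinM lte_fin /=.
  rewrite mulrC ltr_pdivrMr ?pmulrn_lgt0// => /ltW /le_trans; apply.
  rewrite le_eqVlt; apply/orP; left; apply/eqP; rewrite -mulr_natr.
  by field; rewrite gt_eqF.
have ik := integrable_derive1_ramp x tp.
have iuk : integ (fun z => u z * derive1 (ramp t x) z).
  apply: (integrableM_bounded (C := C / t) iu) => [|z]; last exact: CP.
  apply: continuous_measurable_fun; exact: continuous_derive1_ramp.
have ixk : integ (fun z => u x * derive1 (ramp t x) z).
  exact: integrable_scale.
rewrite -[X in _ - X]mulr1 -(Rintegral_derive1_ramp x tp).
rewrite -RintegralZl// -RintegralB//.
apply: (le_trans (le_normr_Rintegral _ _)) => //.
  exact: (integrable_sub iuk ixk).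
apply: (@le_trans _ _ (\int[mu]_z (C / t * w z))).
  apply: le_Rintegral => //.
  - apply: integrable_norm; exact: (integrable_sub iuk ixk).
  - exact: (integrable_scale (C / t) iw).
  move=> z _ /=; rewrite -mulrBl normrM mulrC /w patchE.
  have [zI|zI] := boolP (z \in `[x, x + t]).
    rewrite ifT; first by rewrite ler_wpM2r// CP.
    rewrite inE /B /ball/= ltr_norml; move: zI; rewrite in_itv/= => /andP[? ?].
    by apply/andP; split; lra.
  rewrite derive1_ramp_out// normr0 mul0r mulr_ge0// ?divr_ge0 ?(ltW C0) ?(ltW tp)//.
  by case: ifP.
rewrite RintegralZl//.
rewrite (le_trans (ler_wpM2l _ wle)) ?divr_ge0 ?(ltW C0) ?(ltW tp)//.
by rewrite le_eqVlt; apply/orP; left; apply/eqP; field; rewrite !gt_eqF.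
Qed.

End Ramp.

(** * Modulus of continuity from a weak derivative *)

Section Modulus.
Context {R : realType}.
Implicit Types (u f g h : R -> R) (x y z t : R).
Local Notation mu := (@lebesgue_measure R).
Local Notation integ f := (mu.-integrable [set: R] (EFin \o f)).

(** A smooth version of the indicator of [x, y]; its derivative is a bump at x
    minus a bump at y. *)
Definition plateau t x y z : R := ramp t x z + - 1 * ramp t y z.

Lemma differentiable_upto_plateau m t x y :
  differentiable_upto m (plateau t x y).
Proof.
apply: differentiable_uptoD; last apply: differentiable_upto_scale;
  exact: differentiable_upto_ramp.
Qed.

Lemma derive1_plateau t x y z :
  derive1 (plateau t x y) z = derive1 (ramp t x) z - derive1 (ramp t y) z.
Proof.
have dp := is_deriveD (is_derive_ramp t x z)
  (is_deriveZ (- 1) (is_derive_ramp t y z)).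
by rewrite derive1E (derive_val (is_derive := dp)) /GRing.scale/= mulN1r.
Qed.

Lemma plateau_out t x y z : 0 < t -> x < y -> z \notin `[x, y + t] ->
  plateau t x y z = 0.
Proof.
move=> t0 xy; rewrite in_itv/= negb_and -!ltNge /plateau => /orP[zx|zy].
  by rewrite !ramp_eq0 ?mulr0 ?addr0// ltW// (lt_trans zx).
by rewrite !ramp_eq1 ?mulr1 ?subrr// ltW// (lt_trans _ zy)// ltrD2r.
Qed.

Lemma plateau_norm t x y z : `|plateau t x y z| <= 1.
Proof.
rewrite /plateau mulN1r ler_norml.
have /andP[h1 h2] := @smooth_step_itv R (t^-1 * z + - (t^-1 * x)).
have /andP[h3 h4] := @smooth_step_itv R (t^-1 * z + - (t^-1 * y)).
by apply/andP; split; rewrite /ramp; lra.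
Qed.

Lemma plateau_test_function (r : R) t x y : 0 < t -> x < y -> - r < x -> y + t < r ->
  test_function `](- r), r[%classic (plateau t x y).
Proof.
move=> t0 xy rx yr.
have sub : closure [set z | plateau t x y z != 0] `<=` `[x, y + t]%classic.
  rewrite [X in _ `<=` X](closure_id _).1; last exact: itv_closed.
  apply: closureS => z /=; apply: contraNP => /negP zI.
  by apply/eqP; exact: plateau_out.
split.
- by move=> m z; apply: derivable_derive1n; exact: differentiable_upto_plateau.
- apply: subclosed_compact sub; first exact: closed_closure.
  exact: segment_compact.
- apply: (subset_trans sub) => z /=; rewrite !in_itv/= => /andP[xz zy].
  by rewrite (lt_le_trans rx)//= (le_lt_trans zy).
Qed.

(** Test the weak derivative against the plateau from x to y. On one side the
    two bumps evaluate h x - h y at Lebesgue points; on the other side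
    stands the integral of g over an interval of length about y - x. There
    |g| <= lam g^2 / 2 + 1 / (2 lam) replaces the Cauchy-Schwarz inequality: it
    leads to a modulus that is affine in y - x, and so is any combination of
    such moduli. *)
Lemma weak_derivative_modulus (r : R) h g (G : R) x y (lam : R)
    (D := `](- r), r[%classic) :
  inL2 D h -> inL2 D g -> is_weak_derivative D h g ->
  \int[mu]_z ((g \_ D) z ^+ 2) <= G ->
  lebesgue_pt (h \_ D) x -> lebesgue_pt (h \_ D) y ->
  - r < x -> x < y -> y < r -> 0 < lam ->
  `|h x - h y| <= lam * G / 2 + (y - x) / (2 * lam).
Proof.
move=> Lh Lg wd gG hx hy rx xy yr lam0.
have [iu _] := inL2_integrable Lh.
have [iv iv2] := inL2_integrable Lg.
set u := h \_ D in iu hx hy; set v := g \_ D in iv iv2 gG.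
have -> : h x = u x by rewrite /u patchE mem_set// /D/= in_itv/= rx (lt_trans xy).
have -> : h y = u y by rewrite /u patchE mem_set// /D/= in_itv/= yr (lt_trans rx).
apply/ler_addgt0Pr => d d0.
pose e := d / (2 + (2 * lam)^-1).
have k0 : 0 < 2 + (2 * lam)^-1 by rewrite addr_gt0// invr_gt0 mulr_gt0.
have e0 : 0 < e by rewrite divr_gt0.
have [tx tx0 txP] := lebesgue_pt_ramp iu hx e0.
have [ty ty0 tyP] := lebesgue_pt_ramp iu hy e0.
pose t := Num.min (Num.min tx ty) (Num.min e (r - y)) / 2.
have ry0 : 0 < r - y by rewrite subr_gt0.
have m0 : 0 < Num.min (Num.min tx ty) (Num.min e (r - y)) by rewrite !lt_min tx0 ty0 e0 ry0.
have t0 : 0 < t by rewrite divr_gt0.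
have : t < Num.min (Num.min tx ty) (Num.min e (r - y)) by rewrite /t; lra.
rewrite !lt_min => /andP[/andP[ttx tty] /andP[te try_]].
have {}txP := txP _ t0 ttx; have {}tyP := tyP _ t0 tty.
have [C C0 CP] := @derive1_ramp_bounded R.
have ik x' : integ (fun z => u z * derive1 (ramp t x') z).
  apply: (integrableM_bounded (C := C / t) iu) => [|z]; last exact: CP.
  apply: continuous_measurable_fun; exact: continuous_derive1_ramp.
have cp : continuous (plateau t x y).
  exact: differentiable_upto_continuous (differentiable_upto_plateau 1 t x y).
have mp := continuous_measurable_fun cp.
have ivp : integ (fun z => v z * plateau t x y z).
  by apply: (integrableM_bounded (C := 1) iv mp) => z; exact: plateau_norm.
have E : \int[mu]_z (u z * derive1 (ramp t x) z) - \int[mu]_z (u z * derive1 (ramp t y) z)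
    = - \int[mu]_z (v z * plateau t x y z).
  rewrite -RintegralB//.
  have := wd _ (plateau_test_function t0 xy rx _); rewrite -ltrBrDl => /(_ try_).
  rewrite [LHS]Rintegral_mkcond [X in _ = - X]Rintegral_mkcond => wdE.
  transitivity (\int[mu]_z ((fun z => h z * derive1 (plateau t x y) z) \_ D) z).
    apply: eq_Rintegral => z _; rewrite /u !patchE; case: ifP => _.
      by rewrite derive1_plateau mulrBr.
    by rewrite !mul0r subrr.
  rewrite wdE; congr (- _); apply: eq_Rintegral => z _.
  by rewrite /v !patchE; case: ifP => _; rewrite ?mul0r.
have iI : integ (\1_(`[x, y + t]%classic)) by exact: integrable_indic_itv.
(* The pointwise bound |v| <= lam v^2 / 2 + 1 / (2 lam) on the support. *)
have B : `|\int[mu]_z (v z * plateau t x y z)| <= lam / 2 * G + (2 * lam)^-1 * (y + t - x).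
  apply: (le_trans (le_normr_Rintegral _ _)) => //.
  have i1 := integrable_scale (lam / 2) iv2.
  have i2 := integrable_scale (2 * lam)^-1 iI.
  apply: (@le_trans _ _ (\int[mu]_z (lam / 2 * v z ^+ 2 +
      (2 * lam)^-1 * \1_(`[x, y + t]%classic) z))).
    apply: le_Rintegral => //.
    - exact: integrable_norm.
    - exact: integrable_add.
    move=> z _; have [zI|zI] := boolP (z \in `[x, y + t]).
      rewrite indicE mem_set// mulr1 normrM.
      apply: (@le_trans _ _ (`|v z| * 1)); first by rewrite ler_wpM2l// plateau_norm.
      rewrite mulr1 -[X in _ * X + _]real_normK ?num_real//.
      move: `|v z| => s; rewrite -subr_ge0.
      have -> : lam / 2 * s ^+ 2 + (2 * lam)^-1 - s = (lam * s - 1) ^+ 2 / (2 * lam).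
        by field; rewrite gt_eqF.
      by rewrite divr_ge0 ?sqr_ge0// mulr_ge0// ltW.
    rewrite plateau_out// mulr0 normr0 addr_ge0// mulr_ge0 ?sqr_ge0//.
    - by rewrite divr_ge0// ltW.
    - by rewrite invr_ge0 mulr_ge0// ltW.
  rewrite RintegralD// !RintegralZl//.
  rewrite lerD//.
    by rewrite ler_wpM2l// divr_ge0// ltW.
  rewrite ler_wpM2l ?invr_ge0 ?mulr_ge0 ?(ltW lam0)//.
  have EI : mu `[x, y + t]%classic = (y + t - x)%:E.
    by rewrite lebesgue_measure_itv/= lte_fin ifT// (lt_trans xy)// ltrDl.
  by rewrite /Rintegral integral_indic// setIT [X in fine X]EI.
have tri : `|u x - u y| <= e + e + `|\int[mu]_z (v z * plateau t x y z)|.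
  rewrite -[X in _ <= _ + X]normrN -E; move: txP tyP.
  move: (\int[mu]_z (u z * _)) (\int[mu]_z (u z * _)) => b a h1 h2.
  rewrite distrC in h1.
  have -> : u x - u y = (u x - a) + (b - u y) + (a - b) by ring.
  apply: (le_trans (ler_normD _ _)); apply: lerD; last exact: lexx.
  by apply: (le_trans (ler_normD _ _)); exact: lerD.
apply: (le_trans tri); apply: (le_trans (lerD (lexx (e + e)) B)).
have ct : (2 * lam)^-1 * t <= (2 * lam)^-1 * e.
  by rewrite ler_wpM2l ?invr_ge0 ?mulr_ge0 ?(ltW lam0)// ltW.
have -> : d = e * (2 + (2 * lam)^-1) by rewrite /e mulfVK// gt_eqF.
by move: (2 * lam)^-1 ct => c ct; clear -ct; lra.
Qed.

End Modulus.

(** * Functions against which a sequence becomes negligible *)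

Section Taylor.
Context {R : realType}.
Implicit Types (f df : R -> R) (a b x y : R).

(** The mean value theorem without an ordering of the end points. *)
Lemma mean_value f df a b : (forall x, is_derive x 1 f (df x)) ->
  exists2 c, `|c - a| <= `|b| & f (a + b) - f a = df c * b.
Proof.
move=> fd.
have cf x y : {within `[x, y], continuous f}.
  apply: continuous_subspaceT => z; apply/differentiable_continuous.
  by apply/derivable1_diffP; exact: ex_derive.
have [b0|b0] := leP 0 b.
  have ab : a <= a + b by rewrite lerDl.
  have [c cI cE] := MVT_segment ab (fun x _ => fd x) (cf _ _).
  exists c; last by rewrite cE; congr (_ * _); ring.
  move: cI; rewrite in_itv/= => /andP[ac cb].
  by rewrite !ger0_norm ?subr_ge0//; lra.
have ab : a + b <= a by rewrite gerDl ltW.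
have [c cI cE] := MVT_segment ab (fun x _ => fd x) (cf _ _).
exists c; last by rewrite -opprB cE; ring.
move: cI; rewrite in_itv/= => /andP[ac cb].
by rewrite ler0_norm ?subr_le0// ltr0_norm//; lra.
Qed.

Lemma cos_lipschitz a b : `|cos (a + b) - cos a| <= `|b|.
Proof.
have [c _ ->] := mean_value (df := fun x => - sin x) a b (fun x => is_derive_cos x).
by rewrite normrM normrN ler_piMl// sin_max.
Qed.

Lemma sin_lipschitz a b : `|sin (a + b) - sin a| <= `|b|.
Proof.
have [c _ ->] := mean_value (df := cos) a b (fun x => is_derive_sin x).
by rewrite normrM ler_piMl// cos_max.
Qed.

Lemma taylor1_le f df a b : (forall x, is_derive x 1 f (df x)) ->
  (forall x y, `|df (x + y) - df x| <= `|y|) ->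
  `|f (a + b) - f a - b * df a| <= b ^+ 2.
Proof.
move=> fd dfL; have [c cab ->] := mean_value a b fd.
have -> : df c * b - b * df a = b * (df (a + (c - a)) - df a).
  by rewrite (_ : a + (c - a) = c); ring.
rewrite normrM -real_normK ?num_real// expr2 ler_wpM2l//.
exact: le_trans (dfL _ _) cab.
Qed.

Lemma cos_taylor1 a b : `|cos (a + b) - cos a + b * sin a| <= b ^+ 2.
Proof.
have := @taylor1_le cos (fun x => - sin x) a b (fun x => is_derive_cos x).
by rewrite mulrN opprK; apply => x y; rewrite -opprD normrN sin_lipschitz.
Qed.

Lemma sin_taylor1 a b : `|sin (a + b) - sin a - b * cos a| <= b ^+ 2.
Proof.
exact: (@taylor1_le sin cos a b (fun x => is_derive_sin x) cos_lipschitz).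
Qed.

End Taylor.

Section WeaklyNull.
Context {R : realType}.
Implicit Types (phi psi : R -> R) (a b r x w : R).
Local Notation mu := (@lebesgue_measure R).
Local Notation integ f := (mu.-integrable [set: R] (EFin \o f)).

(** Continuity is part of the definition because [f j] is only known to be
    integrable with bounded support, and a product with a continuous function
    stays integrable. *)
Definition weakly_null (f : nat -> R -> R) phi : Prop :=
  continuous phi /\ (\int[mu]_z (f j z * phi z)) @[j --> \oo] --> (0 : R).

Definition bounded_sequence r L (f : nat -> R -> R) : Prop :=
  forall j, [/\ integ (f j), \int[mu]_z `|f j z| <= L
              & forall z, r <= `|z| -> f j z = 0].

Lemma integrableM_continuous r u phi : integ u ->
  (forall z, r <= `|z| -> u z = 0) -> continuous phi ->
  integ (fun z => u z * phi z).
Proof.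
move=> iu u0 cphi.
have mup : measurable_fun setT (fun z => u z * phi z).
  apply: measurable_funM; first by apply/measurable_EFinP; case/integrableP: iu.
  exact: continuous_measurable_fun.
have [r0|r0] := ltP r 0.
  apply: (integrable_le mup (integrable_norm iu)) => z.
  have -> : u z = 0 by apply: u0; exact: le_trans (ltW r0) (normr_ge0 z).
  by rewrite mul0r normr0; exact: normr_ge0.
have rr : - r <= r by lra.
have [c _ cP] := @EVT_max R (fun t => `|phi t|) (- r) r rr
  (continuous_subspaceT (fun t => continuous_comp (cphi t) (@norm_continuous _ _ _))).
have iu' := integrable_scale `|phi c| (integrable_norm iu).
apply: (integrable_le mup iu') => z; have [rz|zr] := leP r `|z|.
  rewrite (u0 z rz) mul0r normr0; apply: mulr_ge0; exact: normr_ge0.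
rewrite /= normrM mulrC; apply: ler_wpM2r => //; apply: cP.
by rewrite in_itv/= -ler_norml ltW.
Qed.

Lemma weakly_null_comb f r L phi psi a b : bounded_sequence r L f ->
  weakly_null f phi -> weakly_null f psi ->
  weakly_null f (fun z => a * phi z + b * psi z).
Proof.
move=> bf [cphi fphi] [cpsi fpsi]; split.
  by move=> z; apply: cvgD; apply: cvgM; [exact: cvg_cst|exact: cphi|
    exact: cvg_cst|exact: cpsi].
have -> : (0 : R) = a * 0 + b * 0 by rewrite !mulr0 addr0.
have -> : (fun j => \int[mu]_z (f j z * (a * phi z + b * psi z))) =
   (fun j => a * \int[mu]_z (f j z * phi z) + b * \int[mu]_z (f j z * psi z)).
  apply/funext => j; have [ij _ j0] := bf j.
  have i1 := integrableM_continuous ij j0 cphi.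
  have i2 := integrableM_continuous ij j0 cpsi.
  rewrite -RintegralZl// -RintegralZl// -RintegralD//; last 2 first.
  - exact: integrable_scale.
  - exact: integrable_scale.
  by apply: eq_Rintegral => z _; ring.
by apply: cvgD; apply: cvgM => //; exact: cvg_cst.
Qed.

(** The sequence is bounded in L^1 by L, so replacing phi by a uniform
    approximation on the support costs at most L times the distance, for all
    indices at once. *)
Lemma weakly_null_lim f r L phi : bounded_sequence r L f -> continuous phi ->
  (forall e, 0 < e -> exists2 psi, weakly_null f psi &
    forall z, `|z| < r -> `|phi z - psi z| <= e) ->
  weakly_null f phi.
Proof.
move=> bf cphi approx; split => //; apply/cvgr0Pnorm_le => /= e e0.
have L1 : 0 < `|L| + 1 by rewrite ltr_wpDl.
have d0 : 0 < e / 2 / (`|L| + 1) by rewrite !divr_gt0.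
have [psi [cpsi npsi] close] := approx _ d0.
move/cvgr0Pnorm_le : npsi => /(_ (e / 2)).
rewrite divr_gt0// => /(_ isT); apply: filterS => j small.
have [ij Lj j0] := bf j.
have i1 := integrableM_continuous ij j0 cphi.
have i2 := integrableM_continuous ij j0 cpsi.
have -> : \int[mu]_z (f j z * phi z) =
    \int[mu]_z (f j z * phi z - f j z * psi z) + \int[mu]_z (f j z * psi z).
  by rewrite RintegralB// subrK.
rewrite (le_trans (ler_normD _ _))// [leRHS](splitr e) lerD//.
apply: (le_trans (le_normr_Rintegral _ (integrable_sub i1 i2))) => //.
apply: (@le_trans _ _ (\int[mu]_z (e / 2 / (`|L| + 1) * `|f j z|))).
  apply: le_Rintegral => //.
  - exact/integrable_norm/integrable_sub.
  - exact/integrable_scale/integrable_norm.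
  move=> z _; rewrite -mulrBr normrM mulrC; have [rz|zr] := leP r `|z|.
    by rewrite j0// normr0 !mulr0.
  by rewrite ler_wpM2r// close.
rewrite RintegralZl//; last exact: integrable_norm.
apply: (le_trans (ler_wpM2l (ltW d0) Lj)).
rewrite mulrAC ler_pdivrMr// ler_wpM2l ?divr_ge0 ?(ltW e0)//.
by rewrite (le_trans (ler_norm _))// lerDl.
Qed.

End WeaklyNull.

Section Moments.
Context {R : realType}.
Implicit Types (phi psi g dg : R -> R) (a b r x w z e s t : R) (f : nat -> R -> R).
Local Notation mu := (@lebesgue_measure R).
Local Notation integ f := (mu.-integrable [set: R] (EFin \o f)).

Lemma weakly_null_ext f phi psi : phi =1 psi ->
  weakly_null f phi -> weakly_null f psi.
Proof. by move=> /funext ->. Qed.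

(** The quotient (g ((w + t) y) - g (w y)) / t, where y = z - x, is weakly null
    after multiplication by y^k, and as t tends to 0 it converges to y * dg (w y)
    uniformly for bounded y, with error at most t y^2. The open band leaves room
    for w + t. *)
Lemma weakly_null_difference_quotient f r L x k g dg a b :
  bounded_sequence r L f -> continuous dg ->
  (forall u v, `|g (u + v) - g u - v * dg u| <= v ^+ 2) ->
  (forall w, a < w < b ->
    weakly_null f (fun z => (z - x) ^+ k * g (w * (z - x)))) ->
  forall w, a < w < b ->
    weakly_null f (fun z => (z - x) ^+ k.+1 * dg (w * (z - x))).
Proof.
move=> bf cdg taylor nf w /andP[aw wb].
have cy : continuous (fun z => z - x).
  by move=> z; apply: cvgB; [exact: cvg_id|exact: cvg_cst].
apply: (weakly_null_lim bf).
  move=> z; apply: cvgM.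
    exact: (@continuous_comp _ _ _ (fun z => z - x) (fun y => y ^+ k.+1) z
      (cy z) (@exprn_continuous _ k.+1 _)).
  apply: (@continuous_comp _ _ _ (fun z => w * (z - x)) dg z _ (cdg _)).
  by apply: cvgM; [exact: cvg_cst|exact: cy].
move=> e e0; pose rho := `|r| + `|x| + 1.
have rho0 : 0 < rho by rewrite ltr_wpDl// addr_ge0.
have rk : 0 < rho ^+ k.+2 by rewrite exprn_gt0.
pose t := Num.min (e / rho ^+ k.+2) ((b - w) / 2).
have t0 : 0 < t by rewrite lt_min !divr_gt0// subr_gt0.
have te : t * rho ^+ k.+2 <= e by rewrite -ler_pdivlMr// ge_min lexx.
have tb : t <= (b - w) / 2 by rewrite ge_min lexx orbT.
have wI : a < w < b by rewrite aw.
have wtI : a < w + t < b by apply/andP; split; lra.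
exists (fun z => t^-1 * ((z - x) ^+ k * g ((w + t) * (z - x))) +
                 - t^-1 * ((z - x) ^+ k * g (w * (z - x)))).
  by apply: (weakly_null_comb _ _ bf); exact: nf.
move=> z zr; have yrho : `|z - x| <= rho.
  rewrite (le_trans (ler_normB _ _))// /rho -addrA lerD//.
    by rewrite (le_trans (ltW zr))// ler_norm.
  by rewrite lerDl.
move: (z - x) yrho => y yrho; apply: le_trans te.
have -> : y ^+ k.+1 * dg (w * y) -
    (t^-1 * (y ^+ k * g ((w + t) * y)) + - t^-1 * (y ^+ k * g (w * y))) =
    - (t^-1 * y ^+ k * (g (w * y + t * y) - g (w * y) - t * y * dg (w * y))).
  by rewrite mulrDl exprS; field; rewrite gt_eqF.
rewrite normrN normrM normrM (ger0_norm (x := t^-1)) ?invr_ge0 ?(ltW t0)//.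
apply: (@le_trans _ _ (t^-1 * `|y ^+ k| * (t * y) ^+ 2)).
  by rewrite ler_wpM2l// mulr_ge0// invr_ge0 ltW.
rewrite -[(t * y) ^+ 2]real_normK ?num_real// normrM (gtr0_norm t0) normrX.
have -> : t^-1 * `|y| ^+ k * (t * `|y|) ^+ 2 = t * `|y| ^+ k.+2.
  by rewrite !exprS expr0; field; rewrite gt_eqF.
by rewrite ler_wpM2l ?(ltW t0)// lerXn2r// nnegrE ltW.
Qed.

(** Each power of z - x costs one differentiation in the frequency, which
    exchanges cosine and sine; hence the joint induction. *)
Lemma weakly_null_moments f r L x a b : bounded_sequence r L f ->
  (forall w, a < w < b -> weakly_null f (fun z => cos (w * z)) /\
                          weakly_null f (fun z => sin (w * z))) ->
  forall k w, a < w < b ->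
    weakly_null f (fun z => (z - x) ^+ k * cos (w * (z - x))) /\
    weakly_null f (fun z => (z - x) ^+ k * sin (w * (z - x))).
Proof.
move=> bf nf; elim=> [|k IH] w wI.
  have [nc ns] := nf w wI; split.
    apply: weakly_null_ext (weakly_null_comb (cos (w * x)) (sin (w * x)) bf nc ns).
    by move=> z; rewrite expr0 mul1r mulrBr cosB; ring.
  apply: weakly_null_ext (weakly_null_comb (- sin (w * x)) (cos (w * x)) bf nc ns).
  by move=> z; rewrite expr0 mul1r mulrBr sinB; ring.
split.
  apply: (@weakly_null_difference_quotient f r L x k sin cos a b bf) => //.
  - exact: continuous_cos.
  - exact: sin_taylor1.
  - by move=> w' /IH[].
have ns : weakly_null f (fun z => (z - x) ^+ k.+1 * - sin (w * (z - x))).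
  apply: (@weakly_null_difference_quotient f r L x k cos (fun y => - sin y) a b bf) => //.
  - by move=> y; apply: cvgN; exact: continuous_sin.
  - by move=> u v; rewrite mulrN opprK; exact: cos_taylor1.
  - by move=> w' /IH[].
apply: weakly_null_ext (weakly_null_comb (- 1) 0 bf ns ns) => z; ring.
Qed.

(** Peeling off one factor of the parabola raises the remaining power of z - x
    by 0 or 2, so the induction on [m] has to carry all [k]. *)
Lemma weakly_null_landau f r L x a b (c d : R) : bounded_sequence r L f ->
  (forall w, a < w < b -> weakly_null f (fun z => cos (w * z)) /\
                          weakly_null f (fun z => sin (w * z))) ->
  forall m k w, a < w < b -> weakly_null f (fun z =>
    (c - d * (z - x) ^+ 2) ^+ m * ((z - x) ^+ k * cos (w * (z - x)))).
Proof.
move=> bf nf; elim=> [|m IH] k w wI.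
  apply: weakly_null_ext (proj1 (weakly_null_moments x bf nf k wI)) => z.
  by rewrite expr0 mul1r.
apply: weakly_null_ext (weakly_null_comb c (- d) bf (IH k w wI) (IH k.+2 w wI)).
by move=> z; rewrite !exprS; ring.
Qed.

End Moments.

(** * Concentrating kernels and pointwise convergence *)

Section Concentration.
Context {R : realType}.
Implicit Types (a b r x w z e s t y : R) (f : nat -> R -> R) (N : set R).
Local Notation mu := (@lebesgue_measure R).
Local Notation integ f := (mu.-integrable [set: R] (EFin \o f)).

(** The parabola is normalized to take the value 1 at distance s / 2. Its m-th
    power is then at least 1 up to that distance, while beyond distance s it is
    at most al^m, which tends to 0. Differences of points of ]-r, r[ are
    less than 2 r, whence the range on which it is nonnegative. *)
Lemma landau_kernel r s : 0 < r -> 0 < s < 2 * r ->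
  exists c d al : R, [/\ 0 <= al < 1,
    forall y, `|y| <= s / 2 -> 1 <= c - d * y ^+ 2,
    forall y, `|y| < 2 * r -> 0 <= c - d * y ^+ 2 &
    forall y, s <= `|y| -> c - d * y ^+ 2 <= al].
Proof.
move=> r0 /andP[s0 sr].
have sr2 : s ^+ 2 < 4 * r ^+ 2 by nra.
have k0 : 0 < 16 * r ^+ 2 - s ^+ 2 by nra.
exists (16 * r ^+ 2 / (16 * r ^+ 2 - s ^+ 2)), (4 / (16 * r ^+ 2 - s ^+ 2)),
  ((16 * r ^+ 2 - 4 * s ^+ 2) / (16 * r ^+ 2 - s ^+ 2)).
have sub y : 16 * r ^+ 2 / (16 * r ^+ 2 - s ^+ 2) -
    4 / (16 * r ^+ 2 - s ^+ 2) * y ^+ 2 =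
    (16 * r ^+ 2 - 4 * `|y| ^+ 2) / (16 * r ^+ 2 - s ^+ 2).
  by rewrite real_normK ?num_real//; field; rewrite gt_eqF.
split.
- rewrite divr_ge0 ?(ltW k0)//=; last by nra.
  by rewrite ltr_pdivrMr// mul1r; nra.
- move=> y ys; rewrite sub ler_pdivlMr// mul1r.
  by have := normr_ge0 y; move: `|y| ys => t ts t0; nra.
- move=> y yr; rewrite sub divr_ge0 ?(ltW k0)//.
  by have := normr_ge0 y; move: `|y| yr => t ts t0; nra.
- move=> y sy; rewrite sub ler_wpM2r ?invr_ge0 ?(ltW k0)//.
  by move: `|y| sy => t ts; nra.
Qed.

(** Of the two intervals of length t <= r that end at x, the one on the side of
    the origin lies in ]-r, r[. *)
Lemma one_sided_mass r x t N : - r < x < r -> 0 < t <= r ->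
  measurable N -> mu N = 0%E ->
  (t%:E <= mu ((`](- r)%R, r[%classic `\` N) `&` [set z | `|z - x| <= t]%R))%E.
Proof.
move=> /andP[rx xr] /andP[t0 tr] mN N0.
pose p := if 0 <= x then x - t else x.
pose J : set R := `]p, (p + t)[%classic.
have JE : mu J = t%:E.
  by rewrite lebesgue_measure_itv/= lte_fin ltrDl t0 -EFinD addrAC subrr add0r.
have sub : J `\` N `<=` (`](- r), r[%classic `\` N) `&` [set z | `|z - x| <= t].
  rewrite /J /p => z [/=]; rewrite !in_itv/=.
  have [x0|x0] := leP 0 x => /andP[pz zp] Nz; (split; [split=> //|rewrite ler_norml]);
    apply/andP; split; lra.
have mJ : measurable J by exact: measurable_itv.
have mb : measurable [set z | `|z - x| <= t].
  rewrite (_ : [set z | _] = `[x - t, x + t]%classic); first exact: measurable_itv.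
  apply/seteqP; split => z /=; rewrite in_itv/= ler_norml => /andP[? ?];
  apply/andP; split; lra.
rewrite -JE; apply: (@le_trans _ _ (mu (J `\` N))).
  rewrite [leLHS](_ : _ = mu ((J `\` N) `|` (J `&` N))); last first.
    by rewrite setUC setUIDK.
  apply: (le_trans (measureU2 _ _ _)).
  - exact: measurableD.
  - exact: measurableI.
  rewrite -[leRHS]adde0 leeD2l// -N0 le_measure// inE//.
  exact: measurableI.
apply: le_measure => //; rewrite inE; first exact: measurableD.
apply: measurableI => //; apply: measurableD => //; exact: measurable_itv.
Qed.

End Concentration.

Section Compactness.
Context {R : realType}.
Implicit Types (a b r x w z e s t y : R) (f : nat -> R -> R) (N : set R).
Local Notation mu := (@lebesgue_measure R).
Local Notation integ f := (mu.-integrable [set: R] (EFin \o f)).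

(** Equicontinuity, uniform in the index, in the affine form in which
    [weak_derivative_modulus] provides it; the slope [K] makes the increments
    integrable against a concentrating kernel. *)
Definition equi_continuous_on (E : set R) f : Prop :=
  forall e, 0 < e -> exists2 K : R, 0 <= K &
    forall j x z, E x -> E z -> `|f j x - f j z| <= e + K * `|x - z|.

Lemma norm_indic_le (A A' : set R) z : A `<=` A' -> `|\1_A z : R| <= \1_A' z.
Proof.
move=> AA; rewrite !indicE ger0_norm//.
by have [/set_mem/AA zA|_] := boolP (z \in A); [rewrite mem_set|exact: ler0n].
Qed.

Lemma bounded_sequence_of_sup r B f : 0 < r ->
  (forall j, measurable_fun setT (f j)) -> (forall j z, `|f j z| <= B) ->
  (forall j z, r <= `|z| -> f j z = 0) -> bounded_sequence r (B * (2 * r)) f.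
Proof.
move=> r0 mf fB f0 j.
have iI : integ (\1_(`[- r, r]%classic)) by exact: integrable_indic_itv.
have le1 z : `|f j z| <= B * \1_(`[- r, r]%classic) z.
  have [rz|zr] := leP r `|z|.
    rewrite f0// normr0 mulr_ge0//; exact: le_trans (fB j z).
  rewrite indicE mem_set ?mulr1//=.
  by rewrite in_itv/= -ler_norml ltW.
have ij := integrable_le (mf j) (integrable_scale B iI) le1.
split => //; last exact: f0.
apply: (@le_trans _ _ (\int[mu]_z (B * \1_(`[- r, r]%classic) z))).
  apply: le_Rintegral => //; first exact: integrable_norm.
  exact: integrable_scale.
rewrite RintegralZl// /Rintegral integral_indic// setIT.
have EI : mu `[- r, r]%classic = (2 * r)%:E.
  rewrite lebesgue_measure_itv/= lte_fin ifT; last by lra.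
  by rewrite -EFinD; congr EFin; ring.
by rewrite [X in fine X]EI.
Qed.

(** Let q be the m-th power of a parabola concentrated at x, and S its mass on E.
    Then f_j x S differs from the integral of f_j z q (z - x) cos (w (z - x)) by
    the integral over E of q times f_j x - f_j z cos (w (z - x)), which is at most
    e + L |z - x| by equicontinuity and the Lipschitz bound on the cosine.
    Within a distance s <= e / L of x this is at most 2 e; farther away q is at most
    al^m. As S is bounded below, the error is at most 3 e S for a suitable m,
    and the integral itself tends to 0 by [weakly_null_landau]. *)
Lemma pointwise_null r B N f a b (E := `](- r), r[%classic `\` N) :
  0 < r -> measurable N -> mu N = 0%E -> a < b ->
  (forall j, measurable_fun setT (f j)) -> (forall j z, `|f j z| <= B) ->
  (forall j z, ~ E z -> f j z = 0) -> equi_continuous_on E f ->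
  (forall w, a < w < b -> weakly_null f (fun z => cos (w * z)) /\
                          weakly_null f (fun z => sin (w * z))) ->
  forall x, f j x @[j --> \oo] --> (0 : R).
Proof.
move=> r0 mN N0 ab mf fB f0 ec nf x.
have [Ex|Ex] := pselect (E x); last first.
  by rewrite (_ : (fun j => f j x) = cst 0); [exact: cvg_cst|
    apply/funext => j; rewrite f0].
have f0' j z : r <= `|z| -> f j z = 0.
  move=> rz; apply: f0 => -[/=]; rewrite in_itv/= => zr _.
  by move: rz; rewrite leNgt ltr_norml zr.
have bf := bounded_sequence_of_sup r0 mf fB f0'.
have B0 : 0 <= B by exact: le_trans (fB 0%N x).
pose w := (a + b) / 2.
have wI : a < w < b by rewrite /w; apply/andP; split; lra.
have xI : - r < x < r by case: Ex => /=; rewrite in_itv.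
apply/cvgr0Pnorm_le => /= e e0.
pose e4 := e / 4; have e40 : 0 < e4 by rewrite divr_gt0.
have [K K0 KP] := ec _ e40.
pose L := K + B * `|w| + 1.
have L0 : 0 < L by rewrite ltr_wpDl// addr_ge0// mulr_ge0.
pose s := Num.min (e4 / L) r.
have s0 : 0 < s by rewrite lt_min divr_gt0.
have sr : s <= r by rewrite ge_min lexx orbT.
have sL : L * s <= e4 by rewrite mulrC -ler_pdivlMr// ge_min lexx.
have sr2 : 0 < s < 2 * r by rewrite s0/=; lra.
have [c [d [al [/andP[al0 al1] q1 q0 qal]]]] := landau_kernel r0 sr2.
pose t := s / 2; have t0 : 0 < t by rewrite divr_gt0.
have tr : 0 < t <= r by rewrite t0 /t; lra.
have [m mP] : exists m, L * (2 * r) * (2 * r) * al ^+ m <= e4 * t.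
  have : (L * (2 * r) * (2 * r) * al ^+ m) @[m --> \oo] --> L * (2 * r) * (2 * r) * 0.
    apply: cvgM; first exact: cvg_cst.
    by apply: cvg_expr; rewrite ger0_norm.
  rewrite mulr0 => /cvgr0Pnorm_le => /(_ (e4 * t)).
  rewrite mulr_gt0// => /(_ isT)[m _ mP]; exists m.
  exact: le_trans (ler_norm _) (mP m (leqnn m)).
pose q y := (c - d * y ^+ 2) ^+ m.
have mE : measurable E by apply: measurableD => //; exact: measurable_itv.
have near_x z : E z -> `|z - x| < 2 * r.
  by case=> /=; rewrite in_itv/= ltr_norml => ? _; apply/andP; split; lra.
have cy : continuous (fun z => z - x).
  by move=> z; apply: cvgB; [exact: cvg_id|exact: cvg_cst].
have cq : continuous (fun z => q (z - x)).
  move=> z; apply: (@continuous_comp _ _ _ (fun z => c - d * (z - x) ^+ 2)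
      (fun y => y ^+ m) z _ (@exprn_continuous _ m _)).
  apply: cvgB; first exact: cvg_cst.
  apply: cvgM; first exact: cvg_cst.
  exact: (@continuous_comp _ _ _ (fun z => z - x) (fun y => y ^+ 2) z
    (cy z) (@exprn_continuous _ 2 _)).
have muE : (mu E <= (2 * r)%:E)%E.
  have -> : (2 * r)%:E = mu `](- r)%R, r[%classic.
    rewrite lebesgue_measure_itv/= lte_fin ifT; last by lra.
    by rewrite -EFinD; congr EFin; ring.
  apply: le_measure; rewrite ?inE//.
  by move=> z [].
have iE : integ \1_E.
  apply: (integrable_le (measurable_indic mE)
    (integrable_indic_itv (- r) r true false)) => z.
  apply: norm_indic_le => y [/=]; rewrite !in_itv/= => /andP[yr ry] _.
  by rewrite (ltW yr) ltW.
have E0 z : r <= `|z| -> (\1_E z : R) = 0.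
  move=> rz; rewrite indicE memNset// => -[/=]; rewrite in_itv/= => zr _.
  by move: rz; rewrite leNgt ltr_norml zr.
have iEq := integrableM_continuous iE E0 cq.
set S := \int[mu]_z (\1_E z * q (z - x)) in iEq.
(* On the part of E within s / 2 of x, of measure at least t, q is at least 1. *)
have St : t <= S.
  pose F := E `&` [set z | `|z - x| <= t].
  have mF : measurable F.
    apply: measurableI => //; rewrite (_ : [set z | _] = `[x - t, x + t]%classic).
      exact: measurable_itv.
    apply/seteqP; split => z /=; rewrite in_itv/= ler_norml => /andP[? ?];
    apply/andP; split; lra.
  have iF : integ \1_F.
    apply: (integrable_le (measurable_indic mF) iE) => z.
    by apply: norm_indic_le => y [].
  have FS : \int[mu]_z (\1_F z : R) <= S.
    apply: le_Rintegral => // z _; rewrite !indicE.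
    have [/set_mem[zE zt]|_] := boolP (z \in F).
      by rewrite mem_set// mul1r /q exprn_ege1// q1// (le_trans zt) /t.
    have [/set_mem zE|_] := boolP (z \in E); last by rewrite mul0r.
    by rewrite mul1r exprn_ge0// q0// near_x.
  apply: le_trans FS.
  have tF := one_sided_mass xI tr mN N0.
  rewrite /Rintegral integral_indic// setIT.
  rewrite -[X in X <= _]/(fine t%:E) fine_le//.
  rewrite fin_numElt (lt_le_trans _ (measure_ge0 _ _))// (@le_lt_trans _ _ (mu E))//.
    by apply: le_measure; rewrite ?inE// => z [].
  by rewrite (le_lt_trans muE)// ltry.
have nQ := weakly_null_landau x c d bf nf m 0 wI.
(* The constant 3 e4: one e4 from equicontinuity, one from the slope L within
   distance s, one from the region farther away. *)
have key j : `|f j x * S - \int[mu]_z (f j z * (q (z - x) * ((z - x) ^+ 0 * cos (w * (z - x)))))|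
    <= 3 * e4 * S.
  have i1 := integrable_scale (f j x) iEq.
  have [ij _ _] := bf j.
  have i2 := integrableM_continuous ij (f0' j) nQ.1.
  rewrite -RintegralZl// -RintegralB//.
  apply: (le_trans (le_normr_Rintegral _ (integrable_sub i1 i2))) => //.
  have i3 := integrable_add (integrable_scale (2 * e4) iEq)
    (integrable_scale (L * (2 * r) * al ^+ m) iE).
  apply: (@le_trans _ _ (2 * e4 * S + L * (2 * r) * al ^+ m * (2 * r))).
    apply: (@le_trans _ _ (\int[mu]_z (2 * e4 * (\1_E z * q (z - x)) +
        L * (2 * r) * al ^+ m * \1_E z))).
      apply: le_Rintegral => //.
        exact/integrable_norm/integrable_sub.
      move=> z _; have [zE|zE] := pselect (E z); last first.
        have -> : \1_E z = 0 :> R by rewrite indicE memNset.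
        by rewrite (f0 j z zE) !mul0r !mulr0 subrr normr0 addr0.
      have -> : \1_E z = 1 :> R by rewrite indicE mem_set.
      rewrite !mul1r ?expr0 ?mul1r mulr1.
      have qz : 0 <= q (z - x) by rewrite exprn_ge0// q0// near_x.
      rewrite -/(q (z - x)).
      rewrite (_ : _ - _ = q (z - x) * (f j x - f j z * cos (w * (z - x)))); last by ring.
      rewrite normrM (ger0_norm qz).
      have D1 : `|f j x - f j z * cos (w * (z - x))| <= e4 + L * `|z - x|.
        have -> : f j x - f j z * cos (w * (z - x)) =
            (f j x - f j z) + f j z * (1 - cos (w * (z - x))) by ring.
        rewrite (le_trans (ler_normD _ _))// normrM.
        have c1 : `|1 - cos (w * (z - x))| <= `|w| * `|z - x|.
          have := cos_lipschitz 0 (w * (z - x)).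
          by rewrite add0r cos0 distrC normrM.
        apply: (@le_trans _ _ (e4 + K * `|z - x| + B * (`|w| * `|z - x|))).
          apply: lerD; last exact: ler_pM.
          by rewrite (distrC z); exact: KP.
        have := normr_ge0 (z - x); rewrite /L mulrA; move: (`|z - x|) (B * `|w|).
        by clear => y bw y0; lra.
      apply: (le_trans (ler_wpM2l qz D1)).
      have y2 : `|z - x| <= 2 * r by rewrite ltW// near_x.
      have [sz|/ltW zs] := leP s `|z - x|.
        have qa : q (z - x) <= al ^+ m.
          by rewrite lerXn2r ?nnegrE ?q0 ?near_x ?qal.
        have h1 : q (z - x) * (L * `|z - x|) <= al ^+ m * (L * (2 * r)).
          by apply: ler_pM => //; [rewrite mulr_ge0// ltW|rewrite ler_wpM2l// ltW].
        have h2 : 0 <= q (z - x) * e4 by rewrite mulr_ge0// ltW.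
        rewrite mulrDr; move: (al ^+ m) (q (z - x)) `|z - x| h1 h2.
        by clear => A Q y h1 h2; lra.
      have h1 : q (z - x) * (L * `|z - x|) <= q (z - x) * e4.
        by rewrite ler_wpM2l// (le_trans _ sL)// ler_wpM2l// ltW.
      have h2 : 0 <= L * (2 * r) * al ^+ m.
        by rewrite !mulr_ge0// ?exprn_ge0// ltW.
      by rewrite mulrDr; lra.
    rewrite RintegralD//; last 2 first.
    - exact: integrable_scale.
    - exact: integrable_scale.
    rewrite !RintegralZl// lerD2l ler_wpM2l//.
      by rewrite !mulr_ge0// ?exprn_ge0// ltW.
    rewrite /Rintegral integral_indic// setIT.
    rewrite -[X in _ <= X]/(fine (2 * r)%:E) fine_le//.
    by rewrite ge0_fin_numE// (le_lt_trans muE)// ltry.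
  have eSt : e4 * t <= e4 * S by rewrite ler_wpM2l// ltW.
  by have h := le_trans mP eSt; lra.
have := nQ.2 => /cvgr0Pnorm_le/(_ (e4 * t)).
rewrite mulr_gt0// => /(_ isT); apply: filterS => j small.
have S0 : 0 < S by exact: lt_le_trans St.
rewrite -(ler_pM2r S0) -{1}(gtr0_norm S0) -normrM.
have -> : e * S = 3 * e4 * S + e4 * S by rewrite /e4; field.
set X := \int[mu]_z _ in small.
rewrite -[f j x * S](subrK X) (le_trans (ler_normD _ _))// lerD//.
by rewrite (le_trans small)// ler_wpM2l// ltW.
Qed.

End Compactness.

Section Energy.
Context {R : realType}.
Implicit Types (r B z : R) (f : nat -> R -> R).
Local Notation mu := (@lebesgue_measure R).
Local Notation integ f := (mu.-integrable [set: R] (EFin \o f)).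

Lemma energy_null r B f : 0 < r ->
  (forall j, measurable_fun setT (f j)) -> (forall j z, `|f j z| <= B) ->
  (forall j z, r <= `|z| -> f j z = 0) ->
  (forall x, f j x @[j --> \oo] --> (0 : R)) ->
  \int[mu]_z (f j z ^+ 2) @[j --> \oo] --> (0 : R).
Proof.
move=> r0 mf fB f0 fx.
have iI : integ (\1_(`[- r, r]%classic)) by exact: integrable_indic_itv.
have iG := integrable_scale (B ^+ 2) iI.
have mf2 j : measurable_fun setT (fun z => (f j z ^+ 2)%:E).
  by apply/measurable_EFinP; apply: measurable_funX; exact: mf.
have f2x z : (f j z ^+ 2)%:E @[j --> \oo] --> 0%E.
  apply: cvg_EFin; first exact: nearW.
  rewrite (_ : fine \o _ = (fun j => f j z) * (fun j => f j z)).
    by rewrite -[X in _ --> X](mulr0 0); apply: cvgM; exact: fx.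
  by apply/funext => j; rewrite /= expr2.
have f2G j z : (`|(f j z ^+ 2)%:E| <= (B ^+ 2 * \1_(`[- r, r]%classic) z)%:E)%E.
  rewrite lee_fin ger0_norm ?sqr_ge0//; have [rz|zr] := leP r `|z|.
    by rewrite f0// expr0n/= mulr_ge0// sqr_ge0.
  rewrite indicE mem_set; last by rewrite /= in_itv/= -ler_norml ltW.
  by rewrite mulr1 -real_normK ?num_real// lerXn2r// nnegrE (le_trans _ (fB j z)).
have fae : {ae mu, forall z, [set: R] z ->
    (f j z ^+ 2)%:E @[j --> \oo] --> cst 0%E z}.
  by apply: aeW => z _; exact: f2x.
have dom : {ae mu, forall z (j : nat), [set: R] z ->
    (`|(f j z ^+ 2)%:E| <= (B ^+ 2 * \1_(`[- r, r]%classic) z)%:E)%E}.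
  by apply: aeW => z j _; exact: f2G.
have [_ _ H] := @dominated_convergence _ _ R mu setT measurableT
  (fun j z => (f j z ^+ 2)%:E) (cst 0%E) _ mf2 (measurable_cst _) fae iG dom.
move: H; rewrite integral_cst// mul0e => H.
exact: fine_cvg H.
Qed.

End Energy.

(** * Regularity of functions in a Sobolev ball *)

Section Sobolev.
Context {R : realType}.
Implicit Types (r M x y z lam : R) (h g : R -> R) (N : set R).
Local Notation mu := (@lebesgue_measure R).
Local Notation integ f := (mu.-integrable [set: R] (EFin \o f)).

Lemma Rintegral_sqr_le u M : integ (fun z => u z ^+ 2) ->
  (\int[mu]_z (u z ^+ 2)%:E <= (M ^+ 2)%:E)%E -> \int[mu]_z (u z ^+ 2) <= M ^+ 2.
Proof.
move=> iu uM; rewrite -[X in _ <= X]/(fine (M ^+ 2)%:E) fine_le//.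
exact: integrable_fin_num.
Qed.

Lemma H1norm_le (A : set R) h M : 0 <= M -> (H1norm A h <= M%:E)%E ->
  (L2norm A h ^+ 2 <= (M ^+ 2)%:E)%E /\
  (L2norm A (weak_derivative A h) ^+ 2 <= (M ^+ 2)%:E)%E.
Proof.
move=> M0; rewrite /H1norm; set X := (L2norm A h ^+ 2)%E.
set Y := (L2norm A (weak_derivative A h) ^+ 2)%E => XYM.
have sqr_ge0 k : (0 <= L2norm A k ^+ 2)%E.
  by rewrite L2norm_sqr integral_ge0// => z _; rewrite lee_fin sqr_ge0.
have X0 : (0 <= X)%E := sqr_ge0 _; have Y0 : (0 <= Y)%E := sqr_ge0 _.
have XY : (X + Y <= (M ^+ 2)%:E)%E.
  rewrite -(poweR_half_sqr (adde_ge0 X0 Y0)).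
  have P0 := poweR_ge0 (X + Y)%E 2^-1.
  case: ((X + Y) `^ 2^-1)%E P0 XYM => [p||]//.
  by rewrite -EFin_expe !lee_fin => p0 pM; rewrite lerXn2r// nnegrE.
by split; apply: le_trans XY; [rewrite leeDl|rewrite leeDr].
Qed.

Lemma weak_derivativeP (A : set R) h : inH1 A h ->
  inL2 A (weak_derivative A h) /\ is_weak_derivative A h (weak_derivative A h).
Proof. by move=> [_ hg]; exact: (xgetPex (cst 0) hg). Qed.

(** The first two terms bound |h| at some point of the interval, because the
    integral of h^2 is at most M^2; the others are the oscillation given by
    [weak_derivative_modulus] with lam = 1 over a length of at most 2 r. *)
Definition sup_bound r M : R := M ^+ 2 / r + 2 + (M ^+ 2 / 2 + r).

(** The null set covers the points that are not Lebesgue points of h. *)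
Lemma H1_regular r h M (D := `](- r), r[%classic) :
  0 < r -> 0 <= M -> inH1 D h -> (H1norm D h <= M%:E)%E ->
  exists N, [/\ measurable N, mu N = 0%E,
    forall x y lam, (D `\` N) x -> (D `\` N) y -> 0 < lam ->
      `|h x - h y| <= lam * M ^+ 2 / 2 + `|x - y| / (2 * lam) &
    forall x, (D `\` N) x -> `|h x| <= sup_bound r M].
Proof.
move=> r0 M0 H1h hM; have [Lh _] := H1h.
have [Lg wd] := weak_derivativeP H1h; have [h2M g2M] := H1norm_le M0 hM.
have [ih ih2] := inL2_integrable Lh; have [_ ig2] := inL2_integrable Lg.
rewrite !L2norm_sqr in h2M g2M.
have {}h2M := Rintegral_sqr_le ih2 h2M; have {}g2M := Rintegral_sqr_le ig2 g2M.
have [N [mN N0 Nleb]] := lebesgue_differentiation (open_integrable_locally openT ih).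
have lebP x : ~ N x -> lebesgue_pt (h \_ D) x.
  by move=> Nx; apply: contrapT => lx; apply: Nx; exact: Nleb.
have modulus x y lam : (D `\` N) x -> (D `\` N) y -> 0 < lam ->
      `|h x - h y| <= lam * M ^+ 2 / 2 + `|x - y| / (2 * lam).
  wlog xy : x y / x < y.
    move=> W Ex Ey lam0; have [xy|yx|->] := ltgtP x y.
    - exact: W.
    - by rewrite distrC (distrC x); exact: W.
    - by rewrite !subrr normr0 mul0r addr0 divr_ge0// mulr_ge0 ?sqr_ge0// ltW.
  move=> [Dx Nx] [Dy Ny] lam0; rewrite (distrC x) (gtr0_norm (x := y - x)) ?subr_gt0//.
  move: Dx Dy; rewrite /D /= !in_itv/= => /andP[rx _] /andP[_ yr].
  by apply: (weak_derivative_modulus Lh Lg wd g2M) => //; exact: lebP.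
exists N; split => //.
pose F := (D `\` N) `&` [set z | `|z - 0| <= r].
have mF : measurable F.
  apply: measurableI; first by apply: measurableD => //; exact: measurable_itv.
  rewrite (_ : [set z | _] = `[- r, r]%classic); first exact: measurable_itv.
  by apply/seteqP; split => z /=; rewrite in_itv/= subr0 ler_norml.
have [y Fy hy] : exists2 y, F y & `|h y| <= M ^+ 2 / r + 2.
  apply: contrapT => noy.
  pose c := M ^+ 2 / r + 1.
  have c0 : 0 < c by rewrite ltr_wpDl// divr_ge0 ?sqr_ge0// ltW.
  have big z : F z -> c <= h z ^+ 2.
    move=> Fz; have /negP : ~ (`|h z| <= M ^+ 2 / r + 2) by move=> ?; apply: noy; exists z.
    rewrite -ltNge -[h z ^+ 2]real_normK ?num_real// /c => hz; move: c0 hz.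
    by rewrite /c; move: (M ^+ 2 / r) `|h z| => q t; nra.
  have iF : integ \1_F.
    apply: (integrable_le (measurable_indic mF)
      (integrable_indic_itv (- r) r true false)) => z.
    by apply: norm_indic_le => t [_] /=; rewrite subr0 ler_norml in_itv.
  have : \int[mu]_z (c * \1_F z) <= M ^+ 2.
    apply: le_trans h2M; apply: le_Rintegral => //; first exact: integrable_scale.
    move=> z _; rewrite indicE; have [/set_mem Fz|_] := boolP (z \in F).
      by rewrite mulr1 patchE mem_set ?big//; case: Fz => -[].
    by rewrite mulr0 sqr_ge0.
  rewrite RintegralZl// /Rintegral integral_indic// setIT.
  have rI : - r < 0 < r by apply/andP; split; lra.
  have rr : 0 < r <= r by rewrite r0/=.
  have rF := one_sided_mass rI rr mN N0.
  have fF : mu F \is a fin_num.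
    have := integrable_fin_num measurableT iF.
    by rewrite integral_indic// setIT.
  have : r <= fine (mu F) by rewrite -[X in X <= _]/(fine r%:E) fine_le.
  move: (fine _) => m rm cm.
  have : c * r <= M ^+ 2 by rewrite (le_trans _ cm)// ler_wpM2l// ltW.
  by rewrite /c mulrDl mul1r divfK ?gt_eqF//; lra.
move=> x Ex; have [Ey _] := Fy.
have := modulus x y 1 Ex Ey ltr01; rewrite mul1r mulr1 => xy.
have d2 : `|x - y| <= 2 * r.
  move: Ex Ey => [+ _] [+ _]; rewrite /D /= !in_itv/= => /andP[? ?] /andP[? ?].
  by rewrite ler_norml; apply/andP; split; lra.
have := ler_normD (h x - h y) (h y); rewrite subrK /sup_bound; lra.
Qed.

End Sobolev.

(** * Fourier data on a band of frequencies *)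

Section FourierBand.
Context {R : realType}.
Implicit Types (r L w t : R) (u v phi : R -> R) (N : set R).
Local Notation mu := (@lebesgue_measure R).
Local Notation integ f := (mu.-integrable [set: R] (EFin \o f)).

Definition cos_transform u w : R := \int[mu]_z (u z * cos (w * z)).
Definition sin_transform u w : R := \int[mu]_z (u z * sin (w * z)).

Lemma continuous_trig_scale (g : R -> R) w : continuous g ->
  continuous (fun z => g (w * z)).
Proof.
move=> cg z; apply: (@continuous_comp _ _ _ (fun z => w * z) g z _ (cg _)).
by apply: cvgM; [exact: cvg_cst|exact: cvg_id].
Qed.

Lemma integrableM_trig u (g : R -> R) w : integ u -> continuous g ->
  (forall x, `|g x| <= 1) -> integ (fun z => u z * g (w * z)).
Proof.
move=> iu cg g1; apply: (integrableM_bounded (C := 1) iu) => //.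
by apply: continuous_measurable_fun; exact: continuous_trig_scale.
Qed.

(** Stated for a generic kernel so as to serve both transforms. The constant
    comes from |g ((w + t) z) - g (w z)| <= |t z| <= r |t| on the support. *)
Lemma transform_lipschitz r L u (g : R -> R) w t : 0 <= r -> integ u ->
  \int[mu]_z `|u z| <= L -> (forall z, r <= `|z| -> u z = 0) ->
  continuous g -> (forall x, `|g x| <= 1) ->
  (forall x y, `|g (x + y) - g x| <= `|y|) ->
  `|\int[mu]_z (u z * g ((w + t) * z)) - \int[mu]_z (u z * g (w * z))|
    <= r * L * `|t|.
Proof.
move=> r0 iu uL u0 cg g1 gL.
have i1 := integrableM_trig (w + t) iu cg g1.
have i2 := integrableM_trig w iu cg g1.
have iu' : integ (fun z => `|u z|) by exact: integrable_norm.
rewrite -RintegralB//.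
apply: (le_trans (le_normr_Rintegral _ (integrable_sub i1 i2))) => //.
apply: (@le_trans _ _ (\int[mu]_z (r * `|t| * `|u z|))); last first.
  rewrite RintegralZl// mulrAC ler_wpM2r// ler_wpM2l//.
apply: le_Rintegral => //; first exact/integrable_norm/integrable_sub.
  exact: integrable_scale.
move=> z _; have [rz|zr] := leP r `|z|.
  by rewrite u0// !mul0r subrr !normr0 mulr0.
rewrite -mulrBr normrM mulrC ler_wpM2r// mulrDl.
by rewrite (le_trans (gL _ _))// normrM mulrC ler_wpM2r// ltW.
Qed.

Lemma half_sqr_le (x y k : R) : `|y - x| <= k -> x ^+ 2 / 2 - k ^+ 2 <= y ^+ 2.
Proof.
move=> yk; have k0 : 0 <= k by exact: le_trans yk.
have : `|y - x| ^+ 2 <= k ^+ 2 by rewrite lerXn2r// nnegrE.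
rewrite real_normK ?num_real// => h.
have := sqr_ge0 (2 * y - x); nra.
Qed.

(** On ]w, w + t[ the transforms differ from their values at w by at most
    r L t, so the energy density there is at least half its value at w minus a
    quadratic error; integrate this lower bound over the interval. The factor
    1/4 is the one in [Gamma_sub_normc]. *)
Lemma band_energy_pointwise r L u (A : set R) (del w t : R) :
  0 <= r -> 0 <= L -> integ u -> \int[mu]_z `|u z| <= L ->
  (forall z, r <= `|z| -> u z = 0) ->
  measurable A -> 0 < t -> (`]w, (w + t)[%classic `<=` A) ->
  (\int[mu]_(y in A)
     (4^-1 * (cos_transform u y ^+ 2 + sin_transform u y ^+ 2))%:E <= del%:E)%E ->
  cos_transform u w ^+ 2 + sin_transform u w ^+ 2
    <= 8 * del / t + 4 * (r * L * t) ^+ 2.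
Proof.
move=> r0 L0 iu uL u0 mA t0 JA eA.
have clip x y := @transform_lipschitz r L u cos x y r0 iu uL u0
  (@continuous_cos R) (@cos_max R) (@cos_lipschitz R).
have slip x y := @transform_lipschitz r L u sin x y r0 iu uL u0
  (@continuous_sin R) (@sin_max R) (@sin_lipschitz R).
have lip_cont (F : R -> R) : (forall x y, `|F (x + y) - F x| <= r * L * `|y|) ->
    continuous F.
  move=> FL x; apply/cvgrPdist_le => /= e e0.
  have k0 : 0 < r * L + 1 by rewrite ltr_wpDl// mulr_ge0.
  near=> y; have := FL x (y - x); rewrite (_ : x + (y - x) = y); last by ring.
  rewrite distrC => /le_trans; apply.
  apply: (@le_trans _ _ ((r * L + 1) * `|y - x|)).
    by rewrite ler_wpM2r// lerDl.
  rewrite mulrC -ler_pdivlMr// distrC; near: y.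
  by apply: cvgr_dist_le => //; rewrite divr_gt0.
set P := fun y => _ in eA; set X := _ + _.
have mP : measurable_fun setT (fun y => cos_transform u y ^+ 2 + sin_transform u y ^+ 2).
  by apply: measurable_funD; apply: measurable_funX; apply: continuous_measurable_fun;
    apply: lip_cont.
have mPE (A' : set R) : measurable_fun A' P.
  apply: measurable_funTS; rewrite /P; apply/measurable_EFinP.
  exact: measurable_funM.
pose J : set R := `]w, (w + t)[%classic.
have mJ : measurable J by exact: measurable_itv.
pose kap := X / 2 - 2 * (r * L * t) ^+ 2.
have low y : J y -> kap <= cos_transform u y ^+ 2 + sin_transform u y ^+ 2.
  rewrite /J /= in_itv/= => /andP[wy yw].
  have yt : `|y - w| <= t by rewrite gtr0_norm ?subr_gt0//; lra.
  have c1 := clip w (y - w); have s1 := slip w (y - w).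
  have wyE : w + (y - w) = y by ring.
  rewrite wyE in c1 s1.
  have rLt : r * L * `|y - w| <= r * L * t by rewrite ler_wpM2l// mulr_ge0.
  have {}c1 := le_trans c1 rLt; have {}s1 := le_trans s1 rLt.
  have := lerD (half_sqr_le c1) (half_sqr_le s1).
  by rewrite -/(cos_transform u y) -/(cos_transform u w) -/(sin_transform u y)
    -/(sin_transform u w) /kap /X; lra.
have kJ : ((4^-1 * kap)%:E * mu J <= del%:E)%E.
  apply: le_trans eA; apply: (@le_trans _ _ (\int[mu]_(y in J) P y)%E).
    have [k0|k0] := leP kap 0; last first.
      rewrite -integral_cst//; apply: ge0_le_integral => //.
      - by move=> y _; rewrite lee_fin mulr_ge0// ltW.
      - exact (mPE _).
      - by move=> y Jy; rewrite lee_fin ler_wpM2l// low.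
    apply: (@le_trans _ _ 0%E); first by rewrite mule_le0_ge0// lee_fin mulr_ge0_le0.
    by apply: integral_ge0 => y _; rewrite lee_fin mulr_ge0// addr_ge0 ?sqr_ge0.
  apply: ge0_subset_integral => //.
  - exact (mPE _).
  - by move=> y _; rewrite lee_fin mulr_ge0// addr_ge0 ?sqr_ge0.
have mJt : mu J = t%:E.
  by rewrite lebesgue_measure_itv/= lte_fin ltrDl t0 -EFinD addrAC subrr add0r.
move: kJ; rewrite mJt -EFinM lee_fin -ler_pdivlMr// /kap => kd.
by rewrite -[8 * del / t]mulrA; lra.
Unshelve. all: by end_near. Qed.

End FourierBand.

Section GammaNorm.
Context {R : realType}.
Implicit Types (u v : R -> R) (w : R).
Local Notation mu := (@lebesgue_measure R).
Local Notation integ f := (mu.-integrable [set: R] (EFin \o f)).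
Import ComplexField.
Local Open Scope complex_scope.

Lemma normc_sqr (a b : R) : Normc.normc (a +i* b) ^+ 2 = a ^+ 2 + b ^+ 2.
Proof. by rewrite /Normc.normc sqr_sqrtr// addr_ge0 ?sqr_ge0. Qed.

Lemma GammaE u w :
  Gamma u w = 'i%C / (2 * w)%:C * (cos_transform u w +i* sin_transform u w).
Proof.
rewrite /Gamma /Cintegral; congr (_ * (_ +i* _)); apply: eq_Rintegral => z _ /=.
  by rewrite mul0r subr0.
by rewrite mul0r addr0.
Qed.

(** The weight w^2 cancels the factor 1 / (2 w) of [Gamma] up to 1/4, so that the
    weighted norm of the data is half the L^2 norm of the Fourier transform on
    the band. *)
Lemma Gamma_sub_normc u v w : 0 < w -> integ u -> integ v ->
  w ^+ 2 * Normc.normc ((Gamma u \- Gamma v) w) ^+ 2 =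
  4^-1 * (cos_transform (u \- v) w ^+ 2 + sin_transform (u \- v) w ^+ 2).
Proof.
move=> w0 iu iv.
have sub (g : R -> R) : continuous g -> (forall x, `|g x| <= 1) ->
    \int[mu]_z ((u \- v) z * g (w * z)) =
    \int[mu]_z (u z * g (w * z)) - \int[mu]_z (v z * g (w * z)).
  move=> cg g1; rewrite -RintegralB//; [|exact: integrableM_trig..].
  by apply: eq_Rintegral => z _ /=; rewrite mulrBl.
have -> : (Gamma u \- Gamma v) w = Gamma u w - Gamma v w by [].
rewrite !GammaE -mulrBr Normc.normcM exprMn.
have -> : 'i%C / (2 * w)%:C = 0 +i* (2 * w)^-1 :> R[i].
  rewrite -fmorphV/=; simpc.
  by rewrite /=; simpc.
rewrite normc_sqr.
have -> : (cos_transform u w +i* sin_transform u w) -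
    (cos_transform v w +i* sin_transform v w) =
    (cos_transform u w - cos_transform v w) +i* (sin_transform u w - sin_transform v w).
  by simpc.
rewrite normc_sqr /cos_transform /sin_transform.
rewrite (sub _ (@continuous_cos R) (@cos_max R)).
rewrite (sub _ (@continuous_sin R) (@sin_max R)).
by rewrite expr0n/= add0r; field; rewrite gt_eqF.
Qed.

End GammaNorm.

(** * Stability and the final estimate *)

Section Stability.
Context {R : realType}.
Implicit Types (u v h : R -> R) (w a b r L M : R) (N : set R).
Local Notation mu := (@lebesgue_measure R).
Local Notation integ f := (mu.-integrable [set: R] (EFin \o f)).

(** In [band_energy_pointwise] first choose t small, to tame the quadratic
    error, and then the index large. *)
Lemma band_energy_null r L a b (f : nat -> R -> R) (del : nat -> R) :
  0 <= r -> 0 <= L -> bounded_sequence r L f ->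
  (forall j, (\int[mu]_(y in `]a, b[%classic)
    (4^-1 * (cos_transform (f j) y ^+ 2 + sin_transform (f j) y ^+ 2))%:E
      <= (del j)%:E)%E) ->
  del @ \oo --> (0 : R) ->
  forall w, a < w < b -> weakly_null f (fun z => cos (w * z)) /\
                         weakly_null f (fun z => sin (w * z)).
Proof.
move=> r0 L0 bf fdel del0 w /andP[aw wb].
have small e : 0 < e -> \forall j \near \oo,
    cos_transform (f j) w ^+ 2 + sin_transform (f j) w ^+ 2 <= e ^+ 2.
  move=> e0; have k0 : 0 < 4 * (r * L + 1).
    by rewrite mulr_gt0// ltr_wpDl// mulr_ge0.
  pose t := Num.min ((b - w) / 2) (e / (4 * (r * L + 1))).
  have t0 : 0 < t by rewrite lt_min !divr_gt0// subr_gt0.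
  have tb : t <= (b - w) / 2 by rewrite ge_min lexx.
  have rLt : 4 * (r * L * t) <= e.
    have te : t * (4 * (r * L + 1)) <= e by rewrite -ler_pdivlMr// ge_min lexx orbT.
    by apply: le_trans te; clear -t0; lra.
  have rLt0 : 0 <= r * L * t by rewrite !mulr_ge0// ltW.
  move/cvgr0Pnorm_le : del0 => /(_ (e ^+ 2 * t / 16)).
  rewrite divr_gt0 ?mulr_gt0 ?exprn_gt0// => /(_ isT); apply: filterS => j dj.
  have [ij Lj j0] := bf j.
  have JA : `]w, (w + t)[%classic `<=` `]a, b[%classic.
    move=> y /=; rewrite !in_itv/= => /andP[wy yt]; apply/andP; split; lra.
  have mA : measurable (`]a, b[%classic : set R) by exact: measurable_itv.
  have := band_energy_pointwise r0 L0 ij Lj j0 mA t0 JA (fdel j).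
  move=> /le_trans; apply.
  have {}dj : 8 * del j / t <= e ^+ 2 / 2.
    rewrite ler_pdivrMr//; have := le_trans (ler_norm _) dj; lra.
  by move: rLt rLt0 dj; move: (8 * del j / t) (r * L * t) => x k; nra.
have split_sqr (x y e : R) : 0 < e -> x ^+ 2 + y ^+ 2 <= e ^+ 2 -> `|x| <= e.
  move=> e0 xy; rewrite -(ler_pXn2r (n := 2))// ?nnegrE ?(ltW e0)//.
  by rewrite real_normK ?num_real// (le_trans _ xy)// lerDl sqr_ge0.
split; (split; [apply: continuous_trig_scale|apply/cvgr0Pnorm_le => /= e e0]).
- exact: continuous_cos.
- by apply: filterS (small e e0) => j; exact: split_sqr.
- exact: continuous_sin.
- by apply: filterS (small e e0) => j; rewrite addrC; exact: split_sqr.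
Qed.

Lemma eq_integral_off_null (F G : R -> \bar R) N :
  measurable N -> mu N = 0%E -> measurable_fun setT F -> measurable_fun setT G ->
  (forall z, ~ N z -> F z = G z) -> (\int[mu]_z F z = \int[mu]_z G z)%E.
Proof.
move=> mN N0 mF mG FG; apply: ae_eq_integral => //.
by exists N; split => // z /= nFG; apply: contrapT => Nz; apply: nFG => _; exact: FG.
Qed.

(** A sequence of counterexamples with data distances 1, 1/2, 1/3, ... would
    have differences satisfying the assumptions of [pointwise_null] and
    [energy_null], hence tending to 0 in L^2. Removing one null set common to the
    whole sequence lets the almost everywhere bounds of [H1_regular] be used as
    pointwise ones. *)
Lemma stability r a b M (c : R) (D := `](- r), r[%classic) :
  0 < r -> 0 < M -> 0 <= a -> a < b -> 0 < c ->
  exists2 del : R, 0 < del & forall h happ, inH1 D h -> inH1 D happ ->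
    (H1norm D h <= M%:E)%E -> (H1norm D happ <= M%:E)%E ->
    (Hnorm `]a, b[%classic (Gamma (h \_ D) \- Gamma (happ \_ D))%R < del%:E)%E ->
    (L2norm D (h \- happ)%R ^+ 2 <= c%:E)%E.
Proof.
move=> r0 M0 a0 ab c0; apply: contrapT => no.
set A : set R := `]a, b[%classic in no.
have bad (j : nat) : exists p : (R -> R) * (R -> R),
    (inH1 D p.1 /\ inH1 D p.2) /\
    [/\ (H1norm D p.1 <= M%:E)%E, (H1norm D p.2 <= M%:E)%E,
     (Hnorm A (Gamma (p.1 \_ D) \- Gamma (p.2 \_ D))%R < (j.+1%:R^-1)%:E)%E &
     ~ (L2norm D (p.1 \- p.2)%R ^+ 2 <= c%:E)%E].
  apply: contrapT => nj; apply: no; exists j.+1%:R^-1; first by rewrite invr_gt0.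
  by move=> h ha Hh Hha hM haM dh; apply: contrapT => nc; apply: nj; exists (h, ha).
have [p pP] := choice bad.
have [N1 N1P] := choice (fun j => let: conj (conj H _) (And4 HM _ _ _) := pP j in
  H1_regular r0 (ltW M0) H HM).
have [N2 N2P] := choice (fun j => let: conj (conj _ H) (And4 _ HM _ _) := pP j in
  H1_regular r0 (ltW M0) H HM).
pose N := \bigcup_j (N1 j `|` N2 j).
have mN : measurable N.
  by apply: bigcup_measurable => j _; apply: measurableU; [case: (N1P j)|case: (N2P j)].
have N0 : mu N = 0%E.
  have [N' [mN' N'0 NN']] : mu.-negligible N.
    apply: negligible_bigcup => j; apply: negligibleU.
      by have [? ? _ _] := N1P j; exists (N1 j); split.
    by have [? ? _ _] := N2P j; exists (N2 j); split.
  by apply/eqP; rewrite eq_le measure_ge0 andbT -N'0 le_measure// inE.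
pose v j := ((p j).1 \_ D \- (p j).2 \_ D)%R.
pose f j := v j \_ (~` N).
have i1 j : integ ((p j).1 \_ D).
  by have [[[L1 _] _] _] := pP j; have [] := inL2_integrable L1.
have i2 j : integ ((p j).2 \_ D).
  by have [[_ [L1 _]] _] := pP j; have [] := inL2_integrable L1.
have iv j : integ (v j) by exact: integrable_sub.
have mv j : measurable_fun setT (v j) by apply/measurable_EFinP; case/integrableP: (iv j).
have mf j : measurable_fun setT (f j).
  apply/(measurable_restrictT _ _).1; first exact: measurableC.
  exact: measurable_funTS.
have fv j z : ~ N z -> f j z = v j z by move=> Nz; rewrite /f patchE mem_set.
have fE j z : (D `\` N) z -> f j z = (p j).1 z - (p j).2 z.
  by move=> [Dz Nz]; rewrite fv// /v /= !patchE mem_set.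
have f0 j z : ~ (D `\` N) z -> f j z = 0.
  move=> Ez; rewrite /f patchE; case: ifPn => // /set_mem Nz.
  by rewrite /v /= !patchE memNset ?subrr// => Dz; apply: Ez.
have sub1 j z : (D `\` N) z -> (D `\` N1 j) z.
  by move=> [Dz Nz]; split => // ?; apply: Nz; exists j => //; left.
have sub2 j z : (D `\` N) z -> (D `\` N2 j) z.
  by move=> [Dz Nz]; split => // ?; apply: Nz; exists j => //; right.
pose B := sup_bound r M + sup_bound r M.
have B0 : 0 <= B.
  by rewrite /B /sup_bound !addr_ge0 ?divr_ge0 ?sqr_ge0 ?(ltW r0).
have fB j z : `|f j z| <= B.
  have [Ez|Ez] := pselect ((D `\` N) z); last by rewrite f0// normr0.
  rewrite fE// (le_trans (ler_normB _ _))// lerD//.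
    by have [_ _ _ + ] := N1P j; apply; exact: sub1.
  by have [_ _ _ + ] := N2P j; apply; exact: sub2.
have f0' j z : r <= `|z| -> f j z = 0.
  move=> rz; apply: f0 => -[/=]; rewrite /D/= in_itv/= => zr _.
  by move: rz; rewrite leNgt ltr_norml zr.
have ec : equi_continuous_on (D `\` N) f.
  move=> e e0; have M1 : 0 < M ^+ 2 by rewrite exprn_gt0.
  pose lam := e / M ^+ 2; have lam0 : 0 < lam by rewrite divr_gt0.
  exists lam^-1; first by rewrite invr_ge0 ltW.
  move=> j x z Ex Ez; rewrite !fE//.
  have [_ _ + _] := N1P j; move=> /(_ x z lam (sub1 j _ Ex) (sub1 j _ Ez) lam0) m1.
  have [_ _ + _] := N2P j; move=> /(_ x z lam (sub2 j _ Ex) (sub2 j _ Ez) lam0) m2.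
  rewrite (_ : _ - _ - _ = ((p j).1 x - (p j).1 z) - ((p j).2 x - (p j).2 z)); last by ring.
  rewrite (le_trans (ler_normB _ _))// (le_trans (lerD m1 m2))//.
  rewrite (_ : lam * M ^+ 2 = e); last by rewrite /lam divfK// gt_eqF.
  by rewrite le_eqVlt; apply/orP; left; apply/eqP; field; rewrite gt_eqF.
have bf := bounded_sequence_of_sup r0 mf fB f0'.
have int_f j (g : R -> R) : measurable_fun setT g ->
    \int[mu]_z (f j z * g z) = \int[mu]_z (v j z * g z).
  move=> mg; rewrite /Rintegral; congr fine.
  apply: (eq_integral_off_null mN N0).
  - by apply/measurable_EFinP; exact: measurable_funM.
  - by apply/measurable_EFinP; exact: measurable_funM.
  - by move=> z Nz; rewrite fv.
have band j : (\int[mu]_(y in A)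
    (4^-1 * (cos_transform (f j) y ^+ 2 + sin_transform (f j) y ^+ 2))%:E
    <= (j.+1%:R^-1)%:E)%E.
  have [_ [_ _ dj _]] := pP j.
  have Ej : (\int[mu]_(y in A)
      (4^-1 * (cos_transform (f j) y ^+ 2 + sin_transform (f j) y ^+ 2))%:E =
      Hnorm A (Gamma ((p j).1 \_ D) \- Gamma ((p j).2 \_ D))%R ^+ 2)%E.
    rewrite /Hnorm poweR_half_sqr; last first.
      apply: integral_ge0 => y _; rewrite lee_fin mulr_ge0 ?sqr_ge0//.
    apply: eq_integral => y /set_mem; rewrite /A /= in_itv/= => /andP[ay _].
    have y0 : 0 < y by exact: le_lt_trans ay.
    rewrite Gamma_sub_normc// /cos_transform /sin_transform.
    congr ((_ * (_ ^+ 2 + _ ^+ 2))%:E); apply: int_f; apply: continuous_measurable_fun;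
      apply: continuous_trig_scale; [exact: continuous_cos|exact: continuous_sin].
  rewrite Ej; have H0 := poweR_ge0 (\int[mu]_(y in A)
    (y ^+ 2 * ComplexField.Normc.normc ((Gamma ((p j).1 \_ D) \- Gamma ((p j).2 \_ D))%R y) ^+ 2)%:E)%E 2^-1.
  move: dj H0; rewrite -/(Hnorm _ _); case: Hnorm => // d.
  rewrite -EFin_expe !lte_fin !lee_fin => dj d0.
  have j1 : j.+1%:R^-1 <= 1 :> R by rewrite invf_le1// ler1n.
  by move: dj d0 j1; move: (j.+1%:R^-1) => k *; nra.
have nf : forall w, a < w < b -> weakly_null f (fun z => cos (w * z)) /\
                         weakly_null f (fun z => sin (w * z)).
  apply: (band_energy_null (ltW r0) _ bf band).
    by rewrite !mulr_ge0// ltW.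
  exact: cvg_harmonic.
have fx := pointwise_null r0 mN N0 ab mf fB f0 ec nf.
have := energy_null r0 mf fB f0' fx.
move/cvgr0Pnorm_le => /(_ c c0)[j _ /(_ j (leqnn j)) /= fc].
have [_ [_ _ _]] := pP j; apply; rewrite L2norm_sqr.
have -> : (\int[mu]_z ((((p j).1 \- (p j).2)%R \_ D) z ^+ 2)%:E =
    \int[mu]_z (f j z ^+ 2)%:E)%E.
  apply: (eq_integral_off_null mN N0).
  - have -> : ((p j).1 \- (p j).2)%R \_ D = v j.
      apply/funext => z; rewrite /v /= !patchE.
      by case: ifP => _ //; rewrite subr0.
    by apply/measurable_EFinP; exact: measurable_funX.
  - by apply/measurable_EFinP; exact: measurable_funX.
  - move=> z Nz; have [Dz|Dz] := pselect (D z).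
      by rewrite fE// patchE mem_set.
    by rewrite f0 ?patchE ?memNset// => -[].
have if2 : integ (fun z => f j z ^+ 2).
  have iI : integ (\1_(`[- r, r]%classic)) by exact: integrable_indic_itv.
  apply: (integrable_le _ (integrable_scale (B ^+ 2) iI)); first exact: measurable_funX.
  move=> z; rewrite ger0_norm ?sqr_ge0//; have [rz|zr] := leP r `|z|.
    by rewrite f0'// expr0n/= mulr_ge0// sqr_ge0.
  rewrite indicE mem_set; last by rewrite /= in_itv/= -ler_norml ltW.
  by rewrite mulr1 -real_normK ?num_real// lerXn2r// nnegrE.
have /fineK <- : (\int[mu]_z (f j z ^+ 2)%:E)%E \is a fin_num.
  exact: integrable_fin_num.
rewrite lee_fin; exact: le_trans (ler_norm _) fc.
Qed.

End Stability.

Lemma L2norm_sub_sqr_le (R : realType) (r M : R) (h happ : R -> R)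
    (D := `](- r), r[%classic) : 0 <= M -> inH1 D h -> inH1 D happ ->
  (H1norm D h <= M%:E)%E -> (H1norm D happ <= M%:E)%E ->
  (L2norm D (h \- happ)%R ^+ 2 <= (4 * M ^+ 2)%:E)%E.
Proof.
move=> M0 [Lh _] [La _] /(H1norm_le M0)[+ _] /(H1norm_le M0)[+ _].
have [_ ih] := inL2_integrable Lh; have [_ ia] := inL2_integrable La.
rewrite !L2norm_sqr => /(Rintegral_sqr_le ih) hM /(Rintegral_sqr_le ia) aM.
have i2h := integrable_scale 2 ih; have i2a := integrable_scale 2 ia.
have i4 := integrable_add i2h i2a.
apply: (@le_trans _ _ (\int[lebesgue_measure]_z
    (2 * (h \_ D) z ^+ 2 + 2 * (happ \_ D) z ^+ 2)%:E)%E).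
  have m4 : measurable_fun setT (fun z => (2 * (h \_ D) z ^+ 2 + 2 * (happ \_ D) z ^+ 2)%:E).
    by case/integrableP: i4.
  have le4 z : ((((h \- happ)%R \_ D) z ^+ 2)%:E <=
      (2 * (h \_ D) z ^+ 2 + 2 * (happ \_ D) z ^+ 2)%:E)%E.
    rewrite lee_fin !patchE; case: ifP => _ /=; last by rewrite expr0n/= mulr0 addr0.
    by have := sqr_ge0 (h z + happ z); lra.
  have mh : measurable_fun setT ((h \- happ)%R \_ D).
    have -> : (h \- happ)%R \_ D = (h \_ D \- happ \_ D)%R.
      apply/funext => z /=; rewrite !patchE.
      by case: ifP => _ //; rewrite subr0.
    apply: measurable_funB.
      by move: Lh => /andP[/[!inE]].
    by move: La => /andP[/[!inE]].
  apply: ge0_le_integral => //.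
  - by move=> z _; rewrite lee_fin sqr_ge0.
  - by apply/measurable_EFinP; exact: measurable_funX.
have /fineK <- := integrable_fin_num measurableT i4.
rewrite lee_fin; change (\int[lebesgue_measure]_z
    (2 * (h \_ D) z ^+ 2 + 2 * (happ \_ D) z ^+ 2) <= 4 * M ^+ 2).
rewrite RintegralD// !RintegralZl//; lra.
Qed.

Theorem proposition13 (R : realType) (n : nat) (r kmax M eps : R) :
  0 < r -> n%:R * pi < kmax -> 0 < M -> 0 < eps -> eps < 1 ->
  let K : R := kmax + Num.sqrt (kmax ^+ 2 - n%:R ^+ 2 * pi ^+ 2) in
  let D : set R := `](- r), r[%classic in
  let I : set R := `](n%:R * pi), K[%classic in
  exists xi : R,
  forall h happ : R -> R,
    inH1 D h -> inH1 D happ ->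
    (H1norm D h <= M%:E)%E -> (H1norm D happ <= M%:E)%E ->
    let d := Gamma (h \_ D) in
    let dapp := Gamma (happ \_ D) in
    (L2norm D (h \- happ)%R ^+ 2
     <= xi%:E * Hnorm I (d \- dapp)%R `^ (2 - 2 * eps)%R
        + (4 / pi)%:E * Hnorm I (d \- dapp)%R ^+ 2
        + (8 * pi / K ^+ 2 * M ^+ 2)%:E)%E.
Proof.
move=> r0 nk M0 eps0 eps1 K D I.
have npi0 : 0 <= n%:R * pi :> R by rewrite mulr_ge0// pi_ge0.
have nK : n%:R * pi < K by rewrite (lt_le_trans nk)// lerDl sqrtr_ge0.
have K0 : 0 < K by exact: le_lt_trans nK.
have pi0 := @pi_gt0 R.
have c0 : 0 < 8 * pi / K ^+ 2 * M ^+ 2.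
  by rewrite mulr_gt0 ?divr_gt0 ?exprn_gt0// mulr_gt0.
have [del del0 stab] := stability r0 M0 npi0 nK c0.
set p := 2 - 2 * eps.
have p0 : 0 < p by rewrite /p; lra.
exists (4 * M ^+ 2 / del `^ p) => h happ Hh Ha hM aM; lazy zeta.
set d := Gamma (h \_ D); set dapp := Gamma (happ \_ D).
have H0 : (0 <= Hnorm I (d \- dapp)%R)%E by exact: poweR_ge0.
have delp : 0 < del `^ p by exact: powR_gt0.
have [small|large] := ltP (Hnorm I (d \- dapp)%R) del%:E.
  apply: (le_trans (stab h happ Hh Ha hM aM small)).
  rewrite leeDr// adde_ge0// mule_ge0 ?expe_ge0 ?poweR_ge0// lee_fin.
    by rewrite divr_ge0 ?(ltW delp)// mulr_ge0// sqr_ge0.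
  by rewrite divr_ge0// ltW.
apply: (le_trans (L2norm_sub_sqr_le (ltW M0) Hh Ha hM aM)).
rewrite -addeA; apply: (@le_trans _ _ ((4 * M ^+ 2 / del `^ p)%:E *
    Hnorm I (d \- dapp)%R `^ p)%E); last first.
  rewrite leeDl// adde_ge0//; last by rewrite lee_fin ltW.
  by rewrite mule_ge0 ?expe_ge0// lee_fin divr_ge0// ltW.
apply: (@le_trans _ _ ((4 * M ^+ 2 / del `^ p)%:E * del%:E `^ p)%E).
  by rewrite poweR_EFin -EFinM lee_fin divfK// gt_eqF.
rewrite lee_wpmul2l//.
  by rewrite lee_fin divr_ge0 ?(ltW delp)// mulr_ge0// sqr_ge0.
apply: gt0_ler_poweR => //; first exact: ltW.
  by rewrite in_itv/= lee_fin ltW// leey.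
by rewrite in_itv/= H0 leey.
Qed.
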